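(* Let $(X,\Omega)$ be a measurable space, and let $A$ be a $\sigma$-Dedekind complete vector lattice algebra with a positive identity element $e$ and $\sigma$-monotone continuous multiplication. Let $\mu\colon\Omega\to A^+$ be a finite spectral measure. Suppose that $\mu(X)\le e$. Then: (1) $\mu(X)A\mu(X)$ is a vector lattice subalgebra of $A$ that is also a projection band in $A$; (2) $\mathcal L^1(X,\Omega,\mu;\mathbb R)$ is a unital vector lattice algebra, and $I_\mu\colon\mathcal L^1(X,\Omega,\mu;\mathbb R)\to A$ is a vector lattice algebra homomorphism; (3) (a) the image of $\mathcal B(X,\Omega;\mathbb R)$ under $I_\mu$ is contained in the order ideal of $\mu(X)A\mu(X)$ that is generated by $\mu(X)$; (b) the image of $\mathcal L^1(X,\Omega,\mu;\mathbb R)$ under $I_\mu$ is contained in the $\sigma$-order ideal of $\mu(X)A\mu(X)$ that is generated by $\mu(X)$; (4) the kernel of $I_\mu\colon\mathcal L^1(X,\Omega,\mu;\mathbb R)\to A$ is $\mathcal N(X,\Omega,\mu;\mathbb R)$, so that the quotient $L^1(X,\Omega,\mu;\mathbb R)$ is a commutative unital vector lattice algebra. The induced map $I_\mu\colon L^1(X,\Omega,\mu;\mathbb R)\to A$ is an injective vector lattice algebra homomorphism. The space $L^1(X,\Omega,\mu;\mathbb R)$ is $\sigma$-Dedekind complete, and $I_\mu\colon L^1(X,\Omega,\mu;\mathbb R)\to A$ and $I_\mu\colon L^1(X,\Omega,\mu;\mathbb R)\to\mu(X)A\mu(X)$ are both $\sigma$-order continuous. If, in addition, $A$ is monotone complete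 and has the countable sup property, then $L^1(X,\Omega,\mu;\mathbb R)$ is Dedekind complete, it has the countable sup property, and $I_\mu\colon L^1(X,\Omega,\mu;\mathbb R)\to A$ and $I_\mu\colon L^1(X,\Omega,\mu;\mathbb R)\to\mu(X)A\mu(X)$ are both order continuous.
   Context: All vector spaces are over $\mathbb R$; $\mathbb R^+=[0,\infty)$; vector lattices are supposed to be Archimedean. $x_\lambda\uparrow x$ (resp. $x_\lambda\downarrow x$) means that $(x_\lambda)$ is an increasing (resp. decreasing) net with supremum (resp. infimum) $x$. A partially ordered vector space is monotone complete if every increasing net that is bounded above has a supremum. A vector lattice is ($\sigma$-)Dedekind complete if every non-empty (countable) subset that is bounded above has a supremum. $E$ has the countable sup property if, for every net $(x_\lambda)\subseteq E^+$ and $x\in E^+$ with $x_\lambda\uparrow x$, there is a countable set of indices $\{\lambda_n\}$ with $x=\sup_n x_{\lambda_n}$. A positive operator $T$ is order continuous (resp. $\sigma$-order continuous) if $Tx_\lambda\downarrow0$ for every net (resp. sequence) with $x_\lambda\downarrow 0$. A $\sigma$-order ideal is an order ideal that is closed under existing suprema of increasing sequences. A vector lattice algebra $A$ is an associative algebra that is also a vector lattice with $ab\in A^+$ for $a,b\in A^+$. Its multiplication is $\sigma$-monotone continuous if, for all sequences in $A^+$ with $a_n\uparrow a\in A^+$, one has $ba_n\uparrow ba$ and $a_nb\uparrow ab$ for all $b\in A^+$. $\mu(X)A\mu(X)=\{\mu(X)a\mu(X):a\in A\}$. A finite measure $\mu\colon\Omega\to A^+$ is a map with $\mu(\emptyset)=0$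 and $\mu(\bigcup_n\Delta_n)=\bigvee_{N}\sum_{n=1}^N\mu(\Delta_n)$ in $A$ for every pairwise disjoint sequence in the $\sigma$-algebra $\Omega$; it is spectral if $\mu(\Delta_1\cap\Delta_2)=\mu(\Delta_1)\mu(\Delta_2)$ for all $\Delta_1,\Delta_2\in\Omega$. Order integral: for $\varphi=\sum_{i=1}^n r_i\chi_{\Delta_i}$ with $r_i\in\mathbb R^+$ and disjoint $\Delta_i\in\Omega$, $\int_X^{o}\varphi\,d\mu=\sum r_i\mu(\Delta_i)$; for measurable $f\colon X\to[0,\infty]$, $\int_X^{o}f\,d\mu=\bigvee_n\int_X^{o}\varphi_n\,d\mu$ in $A^+\cup\{\infty\}$ ($\infty$ adjoined as largest element) for any sequence of such $\varphi_n\uparrow f$ pointwise (independent of the choice). $\mathcal L^1(X,\Omega,\mu;\mathbb R)$ consists of the measurable $f\colon X\to\mathbb R$ with $\int_X^{o}|f|\,d\mu\in A$, and then $I_\mu(f)=\int^{o}_X f\,d\mu=\int^{o}_Xf^+\,d\mu-\int^{o}_Xf^-\,d\mu$. $\mathcal B(X,\Omega;\mathbb R)$ is the space of bounded measurable functions. $\mathcal N(X,\Omega,\mu;\mathbb R)$ is the set of measurable functions that vanish $\mu$-almost everywhere, and $L^1(X,\Omega,\mu;\mathbb R)=\mathcal L^1/\mathcal N$; the induced map on it is also denoted by $I_\mu$. Function spaces carry pointwise operations and order. *)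

(* Defs.v *)
From HB Require Import structures.
From mathcomp Require Import all_boot all_order all_algebra.
From mathcomp Require Import generic_quotient.
From mathcomp Require Import all_classical all_reals all_analysis.
From mathcomp Require Import measurable_realfun.

Set Implicit Arguments.
Unset Strict Implicit.
Unset Printing Implicit Defensive.

Import Order.TTheory GRing.Theory Num.Theory.
Import numFieldNormedType.Exports.
Import HBNNSimple.

Local Open Scope classical_set_scope.
Local Open Scope ring_scope.

(** * Vector lattices and vector lattice algebras *)

(* The lattice operations are fields over [Num.POrderedZmodule] because
   Hierarchy Builder refuses a join of [Order.Lattice] and [GRing.Lmodule]. *)
HB.mixin Record POrderedLmodule_isVectorLattice (R : realType) V
    of Num.POrderedZmodule V & GRing.Lmodule R V := {
  vjoin : V -> V -> V;
  vmeet : V -> V -> V;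
  vjoinP : forall x y z : V, (vjoin x y <= z) = (x <= z) && (y <= z);
  vmeetP : forall x y z : V, (z <= vmeet x y) = (z <= x) && (z <= y);
  levD2r : forall z x y : V, x <= y -> x + z <= y + z;
  scalev_ge0 : forall (a : R) (x : V), 0 <= a -> 0 <= x -> 0 <= a *: x;
  vlat_archimedean : forall x y : V,
    0 <= x -> (forall n : nat, x *+ n <= y) -> x = 0
}.

#[short(type="vectLatticeType")]
HB.structure Definition VectorLattice (R : realType) :=
  {V of Num.POrderedZmodule V & GRing.Lmodule R V
      & POrderedLmodule_isVectorLattice R V}.
(* Associative, not necessarily unital; hence not built on the ring structures,
   which are unital. *)
HB.mixin Record VectorLattice_isVLAlgebra (R : realType) A
    of VectorLattice R A := {
  vmul : A -> A -> A;
  vmulA : associative vmul;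
  vmulDl : forall x y z : A, vmul (x + y) z = vmul x z + vmul y z;
  vmulDr : forall x y z : A, vmul x (y + z) = vmul x y + vmul x z;
  vmulZl : forall (a : R) (x y : A), vmul (a *: x) y = a *: vmul x y;
  vmulZr : forall (a : R) (x y : A), vmul x (a *: y) = a *: vmul x y;
  vmul_ge0 : forall x y : A, 0 <= x -> 0 <= y -> 0 <= vmul x y
}.
#[short(type="vlAlgType")]
HB.structure Definition VLAlgebra (R : realType) :=
  {A of VectorLattice R A & VectorLattice_isVLAlgebra R A}.

Notation "x ** y" := (vmul x y) (at level 40, left associativity) : ring_scope.

(** * Order-theoretic notions, relative to a subset [D] of the ambient type *)

Section RelativeOrder.
Context {d : Order.disp_t} {T : porderType d}.
Implicit Types (D S : set T) (s x : T).

(* [s] is the supremum (infimum) of [S] in the partially ordered set [D]. *)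
Definition sup_in D S s :=
  [/\ D s, ubound S s & forall u, D u -> ubound S u -> (s <= u)%O].
Definition inf_in D S s :=
  [/\ D s, lbound S s & forall l, D l -> lbound S l -> (l <= s)%O].

Definition directed (I : Type) (leI : I -> I -> Prop) :=
  [/\ inhabited I, forall i, leI i i,
      forall i j k, leI i j -> leI j k -> leI i k
    & forall i j, exists k, leI i k /\ leI j k].

Definition increasing_net (I : Type) (leI : I -> I -> Prop) (u : I -> T) :=
  forall i j, leI i j -> (u i <= u j)%O.
Definition decreasing_net (I : Type) (leI : I -> I -> Prop) (u : I -> T) :=
  forall i j, leI i j -> (u j <= u i)%O.

Definition net_up D (I : Type) (leI : I -> I -> Prop) (u : I -> T) s :=
  increasing_net leI u /\ sup_in D (range u) s.
Definition net_down D (I : Type) (leI : I -> I -> Prop) (u : I -> T) s :=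
  decreasing_net leI u /\ inf_in D (range u) s.

Definition seq_up D (u : nat -> T) s := net_up D (fun m n => (m <= n)%N) u s.
Definition seq_down D (u : nat -> T) s :=
  net_down D (fun m n => (m <= n)%N) u s.

Definition monotone_complete D :=
  forall (I : Type) (leI : I -> I -> Prop) (u : I -> T),
    directed leI -> (forall i, D (u i)) -> increasing_net leI u ->
    (exists2 b, D b & ubound (range u) b) ->
    exists s, sup_in D (range u) s.

Definition dedekind_complete D :=
  forall S, S `<=` D -> S !=set0 -> (exists2 b, D b & ubound S b) ->
    exists s, sup_in D S s.

Definition sigma_dedekind_complete D :=
  forall S, S `<=` D -> S !=set0 -> countable S ->
    (exists2 b, D b & ubound S b) -> exists s, sup_in D S s.

End RelativeOrder.

Section VectorLatticeNotions.
Context {R : realType} {V : vectLatticeType R}.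
Implicit Types (B D I S : set V) (x y : V).

Definition vabs x : V := vjoin x (- x).

Definition countable_sup_property D :=
  forall (I : Type) (leI : I -> I -> Prop) (u : I -> V) x,
    directed leI -> (forall i, D (u i) /\ 0 <= u i) -> 0 <= x ->
    net_up D leI u x ->
    exists l : nat -> I, sup_in D (range (u \o l)) x.

Definition linear_subspace D :=
  D 0 /\ forall (a : R) x y, D x -> D y -> D (a *: x + y).

Definition vector_sublattice D :=
  linear_subspace D /\
  forall x y, D x -> D y -> D (vjoin x y) /\ D (vmeet x y).

Definition order_ideal_in B I :=
  [/\ I `<=` B, linear_subspace I
    & forall x y, B x -> I y -> vabs x <= vabs y -> I x].

Definition sigma_order_ideal_in B I :=
  order_ideal_in B I /\
  forall (u : nat -> V) s, (forall n, I (u n)) -> seq_up B u s -> I s.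

Definition band B :=
  order_ideal_in [set: V] B /\
  forall S s, S `<=` B -> sup_in [set: V] S s -> B s.

Definition disjoint_complement B : set V :=
  [set x | forall y, B y -> vmeet (vabs x) (vabs y) = 0].

Definition projection_band B :=
  band B /\
  forall x, exists y z, [/\ B y, disjoint_complement B z & x = y + z].

End VectorLatticeNotions.

Section Operators.
Context {R : realType}.

(* [T], restricted to [D], as an operator between the partially ordered vector
   spaces [D] and [E]. *)
Definition order_continuous_on {V : vectLatticeType R}
    {W : vectLatticeType R} (D : set V) (E : set W) (T : V -> W) :=
  forall (I : Type) (leI : I -> I -> Prop) (u : I -> V),
    directed leI -> (forall i, D (u i)) -> net_down D leI u 0 ->
    net_down E leI (T \o u) 0.

Definition sigma_order_continuous_on {V : vectLatticeType R}
    {W : vectLatticeType R} (D : set V) (E : set W) (T : V -> W) :=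
  forall u : nat -> V,
    (forall n, D (u n)) -> seq_down D u 0 -> seq_down E (T \o u) 0.

Definition vector_lattice_hom_on {V : vectLatticeType R}
    {W : vectLatticeType R} (D : set V) (T : V -> W) :=
  (forall (a : R) x y, D x -> D y -> T (a *: x + y) = a *: T x + T y) /\
  forall x y, D x -> D y ->
    T (vjoin x y) = vjoin (T x) (T y) /\
    T (vmeet x y) = vmeet (T x) (T y).

Definition vl_algebra_hom_on {A : vlAlgType R} {B : vlAlgType R}
    (D : set A) (T : A -> B) :=
  vector_lattice_hom_on D T /\
  forall x y, D x -> D y -> T (x ** y) = T x ** T y.

End Operators.

Section VLAlgebraNotions.
Context {R : realType} {A : vlAlgType R}.

Definition vl_subalgebra (D : set A) :=
  vector_sublattice D /\ forall x y, D x -> D y -> D (x ** y).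

Definition sigma_monotone_continuous_mul :=
  forall (a : nat -> A) (s : A),
    (forall n, 0 <= a n) -> 0 <= s -> seq_up [set: A] a s ->
    forall b, 0 <= b ->
      seq_up [set: A] (fun n => b ** a n) (b ** s) /\
      seq_up [set: A] (fun n => a n ** b) (s ** b).

Definition is_identity (D : set A) (e : A) :=
  D e /\ forall x, D x -> e ** x = x /\ x ** e = x.

Definition corner (p : A) : set A := range (fun a => p ** a ** p).

End VLAlgebraNotions.
Arguments sigma_monotone_continuous_mul {R} A.


(** * Measurable functions with pointwise operations and order *)

Section MeasurableFunctions.
Context {dX : measure_display} {X : measurableType dX} {R : realType}.
Implicit Types f g h : {mfun X >-> R}.

Definition mfun_le f g := `[< forall x, f x <= g x >].

Lemma mfun_leP f g : reflect (forall x, f x <= g x) (mfun_le f g).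
Proof. exact: asboolP. Qed.

Let mfun_le_refl : reflexive mfun_le.
Proof. by move=> f; apply/mfun_leP. Qed.

Let mfun_le_anti : antisymmetric mfun_le.
Proof.
move=> f g /andP[/mfun_leP fg /mfun_leP gf]; apply/mfuneqP => x.
by apply/eqP; rewrite eq_le fg gf.
Qed.

Let mfun_le_trans : transitive mfun_le.
Proof.
move=> g f h /mfun_leP fg /mfun_leP gh; apply/mfun_leP => x.
exact: le_trans (fg x) (gh x).
Qed.

HB.instance Definition _ := Order.Le_isPOrder.Build ring_display {mfun X >-> R}
  mfun_le_refl mfun_le_anti mfun_le_trans.

Let mfun_joinP f g h : (max_mfun f g <= h) = (f <= h) && (g <= h).
Proof.
apply/mfun_leP/andP => [fgh|[/mfun_leP fh /mfun_leP gh] x].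
  by split; apply/mfun_leP => x; have := fgh x; rewrite ge_max => /andP[].
by rewrite ge_max fh gh.
Qed.

Let mfun_meetP f g h : (h <= min_mfun f g) = (h <= f) && (h <= g).
Proof.
apply/mfun_leP/andP => [fgh|[/mfun_leP fh /mfun_leP gh] x].
  by split; apply/mfun_leP => x; have := fgh x; rewrite le_min => /andP[].
by rewrite le_min fh gh.
Qed.

Let mfun_levD2r h f g : f <= g -> f + h <= g + h.
Proof.
by move=> /mfun_leP fg; apply/mfun_leP => x; rewrite lerD2r; exact: fg.
Qed.

Let mfun_scalev_ge0 (a : R) f : 0 <= a -> 0 <= f -> 0 <= a *: f.
Proof.
move=> a0 /mfun_leP f0; apply/mfun_leP => x.
by apply: mulr_ge0 => //; exact: f0.
Qed.

Lemma real_archimedean (a b : R) :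
  0 <= a -> (forall n : nat, a *+ n <= b) -> a = 0.
Proof.
move=> a0 ab; apply/eqP; rewrite eq_le a0 andbT leNgt; apply/negP => agt0.
have := ab (Num.truncn (b / a)).+1.
by rewrite -mulr_natr mulrC -ler_pdivlMr// leNgt truncnS_gt.
Qed.

Let mfun_archimedean f g : 0 <= f -> (forall n : nat, f *+ n <= g) -> f = 0.
Proof.
move=> /mfun_leP f0 fg; apply/mfuneqP => x.
apply: (@real_archimedean _ (g x) (f0 x)) => n.
by have /mfun_leP/(_ x) := fg n; rewrite mfunMn.
Qed.

HB.instance Definition _ := POrderedLmodule_isVectorLattice.Build R
  {mfun X >-> R} mfun_joinP mfun_meetP mfun_levD2r mfun_scalev_ge0
  mfun_archimedean.

Let mfun_mulZl (a : R) f g : (a *: f) * g = a *: (f * g).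
Proof.
by apply/mfuneqP => x; rewrite !mfunM /= -[RHS]/(a * (f x * g x)) mulrA.
Qed.

Let mfun_mulZr (a : R) f g : f * (a *: g) = a *: (f * g).
Proof. by apply/mfuneqP => x; exact: mulrCA. Qed.

Let mfun_mul_ge0 f g : 0 <= f -> 0 <= g -> 0 <= f * g.
Proof.
move=> /mfun_leP f0 /mfun_leP g0; apply/mfun_leP => x.
by apply: mulr_ge0; [exact: f0|exact: g0].
Qed.

HB.instance Definition _ := VectorLattice_isVLAlgebra.Build R {mfun X >-> R}
  (@mulrA {mfun X >-> R}) (@mulrDl {mfun X >-> R}) (@mulrDr {mfun X >-> R})
  mfun_mulZl mfun_mulZr mfun_mul_ge0.

End MeasurableFunctions.

(** * Finite measures with values in the positive cone of a vector lattice *)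

Record vmeasure (dX : measure_display) (X : measurableType dX) (R : realType)
    (V : vectLatticeType R) := VMeasure {
  vmeasure_fun :> set X -> V;
  vmeasure_ge0 : forall D, measurable D -> 0 <= vmeasure_fun D;
  vmeasure0 : vmeasure_fun set0 = 0;
  vmeasure_sigma_additive : forall F : nat -> set X,
    (forall n, measurable (F n)) -> trivIset [set: nat] F ->
    sup_in [set: V] (range (fun N => \sum_(n < N.+1) vmeasure_fun (F n)))
      (vmeasure_fun (\bigcup_n F n))
}.

Definition spectral (dX : measure_display) (X : measurableType dX)
    (R : realType) (A : vlAlgType R) (mu : vmeasure X A) :=
  forall D E : set X, measurable D -> measurable E ->
    mu (D `&` E) = mu D ** mu E.

Section MeasureTheory.
Context {dX : measure_display} {X : measurableType dX} {R : realType}.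
Context {V : vectLatticeType R} (mu : vmeasure X V).
Implicit Types (f g h : {mfun X >-> R}) (P Q : X -> Prop).

Definition vmeasure_ae P :=
  exists D, [/\ measurable D, mu D = 0 & forall x, ~ D x -> P x].

(* The measurable functions that vanish almost everywhere. *)
Definition calN : set {mfun X >-> R} :=
  [set f | vmeasure_ae (fun x => f x = 0)].

Lemma vmeasure_sub_null (D E : set X) : measurable D -> measurable E ->
  D `<=` E -> mu E = 0 -> mu D = 0.
Proof.
move=> mD mE DE muE0; apply/eqP; rewrite eq_le vmeasure_ge0// andbT -muE0.
have mF n : measurable (bigcup2 D (E `\` D) n).
  by case: n => [|[|n]] //=; exact: measurableD.
have tF : trivIset [set: nat] (bigcup2 D (E `\` D)).
  by move=> [|[|i]] [|[|j]] _ _ //= [x []] //; [move=> ? []|move=> []].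
have [_ ubF _] := vmeasure_sigma_additive mu mF tF.
have := ubF _ (ex_intro2 _ _ 0%N I erefl).
by rewrite bigcup2E setDUK// big_ord1.
Qed.

Lemma vmeasure_bigcup_null (F : nat -> set X) :
  (forall n, measurable (F n)) -> (forall n, mu (F n) = 0) ->
  mu (\bigcup_n F n) = 0.
Proof.
move=> mF F0; rewrite seqDU_bigcup_eq.
have mG n : measurable (seqDU F n) by exact: seqDU_measurable.
have [_ _ leF] := vmeasure_sigma_additive mu mG (@trivIset_seqDU _ F).
apply/eqP; rewrite eq_le vmeasure_ge0 ?andbT; last exact: bigcup_measurable.
apply: leF => // _ [N _ <-]; rewrite big1// => n _.
by apply: vmeasure_sub_null (F0 n) => //; exact: subset_seqDU.
Qed.

Lemma vmeasure_ae_all (P : nat -> X -> Prop) :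
  (forall n, vmeasure_ae (P n)) -> vmeasure_ae (fun x => forall n, P n x).
Proof.
move=> /choice[F PF]; exists (\bigcup_n F n); split.
- by apply: bigcup_measurable => n _; have [] := PF n.
- by apply: vmeasure_bigcup_null => n; have [] := PF n.
- by move=> x nFx n; have [_ _] := PF n; apply => Fnx; apply: nFx; exists n.
Qed.

Lemma vmeasure_aeW P : (forall x, P x) -> vmeasure_ae P.
Proof. by move=> aP; exists set0; split => //; exact: vmeasure0. Qed.

Lemma vmeasure_ae_imply P Q :
  (forall x, P x -> Q x) -> vmeasure_ae P -> vmeasure_ae Q.
Proof. by move=> PQ [D [mD D0 DP]]; exists D; split => // x /DP /PQ. Qed.

Lemma vmeasure_ae_imply2 P Q (S : X -> Prop) : (forall x, P x -> Q x -> S x) ->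
  vmeasure_ae P -> vmeasure_ae Q -> vmeasure_ae S.
Proof.
move=> PQS aP aQ.
have /vmeasure_ae_all : forall n : nat, vmeasure_ae (if n is 0%N then P else Q).
  by case.
by apply: vmeasure_ae_imply => x PQ; apply: PQS;
  [exact: (PQ 0%N)|exact: (PQ 1%N)].
Qed.

(** The order integral. *)

(* For the finitely many values [r] of [phi], the level sets are disjoint and
   [phi] is the sum of the [r * \1_(phi @^-1` [set r])]. *)
Definition sintegral_vm (phi : {nnsfun X >-> R}) : V :=
  \sum_(r \in range phi) r *: mu (phi @^-1` [set r]).

(* Supremum in the positive cone with a largest element [None] adjoined. *)
Definition sup_infty (S : set V) (v : option V) : Prop :=
  match v with
  | Some s => sup_in [set: V] S s
  | None => ~ exists b, ubound S b
  end.

Definition is_ointegral (f : X -> \bar R) (v : option V) :=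
  exists phi : nat -> {nnsfun X >-> R},
    (forall x, seq_up [set: \bar R] (fun n => (phi n x)%:E) (f x)) /\
    sup_infty (range (fun n => sintegral_vm (phi n))) v.

(* A value obtained from some approximating sequence; in the sigma-Dedekind
   complete case it exists for measurable [f >= 0] and does not depend on the
   sequence. *)
Definition ointegral (f : X -> \bar R) : option V := xget None (is_ointegral f).

Definition calL1 : set {mfun X >-> R} :=
  [set f | exists a, ointegral (fun x => `|f x|%:E) = Some a].

Definition Imu (f : {mfun X >-> R}) : V :=
  odflt 0 (ointegral (fun x => (Num.max (f x) 0)%:E)) -
  odflt 0 (ointegral (fun x => (Num.max (- f x) 0)%:E)).

Definition bounded_mfun : set {mfun X >-> R} :=
  [set f | exists M : R, forall x, `|f x| <= M].

End MeasureTheory.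

(** * Measurable functions modulo almost everywhere vanishing ones *)

Section L0.
Context {dX : measure_display} {X : measurableType dX} {R : realType}.
Context {V : vectLatticeType R} (mu : vmeasure X V).
Implicit Types f g h : {mfun X >-> R}.

Definition calN_eq f g := `[< calN mu (f - g) >].

Lemma calN_eqP f g :
  reflect (vmeasure_ae mu (fun x => f x = g x)) (calN_eq f g).
Proof.
apply: (iffP (asboolP _)); apply: vmeasure_ae_imply => x.
  by move=> /eqP; rewrite -[X in X == _]/(f x - g x) subr_eq0 => /eqP.
by move=> fgx; apply/eqP; rewrite -[X in X == _]/(f x - g x) fgx subrr.
Qed.

Let calN_eq_refl : reflexive calN_eq.
Proof. by move=> f; apply/calN_eqP; exact: vmeasure_aeW. Qed.

Let calN_eq_sym : symmetric calN_eq.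
Proof.
by move=> f g; apply/calN_eqP/calN_eqP; apply: vmeasure_ae_imply => x ->.
Qed.

Let calN_eq_trans : transitive calN_eq.
Proof.
move=> g f h /calN_eqP fg /calN_eqP gh; apply/calN_eqP.
by apply: vmeasure_ae_imply2 fg gh => x -> ->.
Qed.

Canonical calN_eq_equiv :=
  EquivRel calN_eq calN_eq_refl calN_eq_sym calN_eq_trans.

Local Open Scope quotient_scope.

Definition L0 : Type := {eq_quot calN_eq}.
HB.instance Definition _ := Choice.on L0.
HB.instance Definition _ := EqQuotient.on L0.

Lemma L0_eqP f g :
  \pi_L0 f = \pi_L0 g <-> vmeasure_ae mu (fun x => f x = g x).
Proof.
by split=> [/eqmodP/calN_eqP//|fg]; apply/eqmodP; exact/calN_eqP.
Qed.

Lemma L0_repr f : vmeasure_ae mu (fun x => repr (\pi_L0 f) x = f x).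
Proof. by apply/L0_eqP; rewrite reprK. Qed.

Definition L0_0 : L0 := \pi_L0 0.
Definition L0_opp (u : L0) : L0 := \pi_L0 (- repr u).
Definition L0_add (u v : L0) : L0 := \pi_L0 (repr u + repr v).
Definition L0_scale (a : R) (u : L0) : L0 := \pi_L0 (a *: repr u).
Definition L0_mul (u v : L0) : L0 := \pi_L0 (repr u * repr v).
Definition L0_join (u v : L0) : L0 := \pi_L0 (max_mfun (repr u) (repr v)).
Definition L0_meet (u v : L0) : L0 := \pi_L0 (min_mfun (repr u) (repr v)).

(* The quotient order: the images of pointwise ordered pairs. *)
Definition L0_le (u v : L0) :=
  `[< exists f g : {mfun X >-> R}, [/\ u = \pi_L0 f, v = \pi_L0 g & f <= g] >].

Lemma L0_addE f g : L0_add (\pi_L0 f) (\pi_L0 g) = \pi_L0 (f + g).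
Proof.
apply/L0_eqP; apply: vmeasure_ae_imply2 (L0_repr f) (L0_repr g) => x.
by move=> fx gx; rewrite -[LHS]/(repr (\pi_L0 f) x + repr (\pi_L0 g) x) fx gx.
Qed.

Lemma L0_oppE f : L0_opp (\pi_L0 f) = \pi_L0 (- f).
Proof.
apply/L0_eqP; apply: vmeasure_ae_imply (L0_repr f) => x.
by move=> fx; rewrite -[LHS]/(- repr (\pi_L0 f) x) fx.
Qed.

Lemma L0_scaleE a f : L0_scale a (\pi_L0 f) = \pi_L0 (a *: f).
Proof.
apply/L0_eqP; apply: vmeasure_ae_imply (L0_repr f) => x.
by move=> fx; rewrite -[LHS]/(a * repr (\pi_L0 f) x) fx.
Qed.

Lemma L0_mulE f g : L0_mul (\pi_L0 f) (\pi_L0 g) = \pi_L0 (f * g).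
Proof.
apply/L0_eqP; apply: vmeasure_ae_imply2 (L0_repr f) (L0_repr g) => x.
by move=> fx gx; rewrite -[LHS]/(repr (\pi_L0 f) x * repr (\pi_L0 g) x) fx gx.
Qed.

Lemma L0_joinE f g : L0_join (\pi_L0 f) (\pi_L0 g) = \pi_L0 (max_mfun f g).
Proof.
apply/L0_eqP; apply: vmeasure_ae_imply2 (L0_repr f) (L0_repr g) => x.
by move=> fx gx /=; rewrite fx gx.
Qed.

Lemma L0_meetE f g : L0_meet (\pi_L0 f) (\pi_L0 g) = \pi_L0 (min_mfun f g).
Proof.
apply/L0_eqP; apply: vmeasure_ae_imply2 (L0_repr f) (L0_repr g) => x.
by move=> fx gx /=; rewrite fx gx.
Qed.

Lemma L0_leP f g :
  reflect (vmeasure_ae mu (fun x => f x <= g x)) (L0_le (\pi_L0 f) (\pi_L0 g)).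
Proof.
apply: (iffP (asboolP _)) => [[f' [g' [/L0_eqP ff' /L0_eqP gg']]]|fg].
  move=> /mfun_leP fg'.
  by apply: vmeasure_ae_imply2 ff' gg' => x -> ->.
exists f, (max_mfun f g); split => //.
- by apply/L0_eqP; apply: vmeasure_ae_imply fg => x /= fgx; rewrite max_r.
- by apply/mfun_leP => x /=; rewrite le_max lexx.
Qed.

Lemma L0_ind (P : L0 -> Prop) : (forall f, P (\pi_L0 f)) -> forall u, P u.
Proof. by move=> Ppi u; rewrite -[u]reprK. Qed.

Let L0_addA : associative L0_add.
Proof.
by elim/L0_ind=> f; elim/L0_ind=> g; elim/L0_ind=> h; rewrite !L0_addE addrA.
Qed.

Let L0_addC : commutative L0_add.
Proof. by elim/L0_ind=> f; elim/L0_ind=> g; rewrite !L0_addE addrC. Qed.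

Let L0_add0 : left_id L0_0 L0_add.
Proof. by elim/L0_ind=> f; rewrite L0_addE add0r. Qed.

Let L0_addN : left_inverse L0_0 L0_opp L0_add.
Proof. by elim/L0_ind=> f; rewrite L0_oppE L0_addE addNr. Qed.

HB.instance Definition _ :=
  GRing.isZmodule.Build L0 L0_addA L0_addC L0_add0 L0_addN.

Lemma pi_L0D f g : \pi_L0 (f + g) = \pi_L0 f + \pi_L0 g :> L0.
Proof. exact/esym/L0_addE. Qed.

Let L0_scalerA a b (u : L0) : L0_scale a (L0_scale b u) = L0_scale (a * b) u.
Proof. by elim/L0_ind: u => f; rewrite !L0_scaleE scalerA. Qed.

Let L0_scale1r : left_id 1 L0_scale.
Proof. by elim/L0_ind=> f; rewrite L0_scaleE scale1r. Qed.

Let L0_scalerDr : right_distributive L0_scale +%R.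
Proof.
move=> a; elim/L0_ind=> f; elim/L0_ind=> g.
by rewrite -pi_L0D !L0_scaleE scalerDr pi_L0D.
Qed.

Let L0_scalerDl (u : L0) : {morph L0_scale^~ u : a b / a + b}.
Proof. by elim/L0_ind: u => f a b; rewrite !L0_scaleE scalerDl pi_L0D. Qed.

HB.instance Definition _ := GRing.Zmodule_isLmodule.Build R L0
  L0_scalerA L0_scale1r L0_scalerDr L0_scalerDl.

Lemma pi_L0Z a f : \pi_L0 (a *: f) = a *: \pi_L0 f :> L0.
Proof. exact/esym/L0_scaleE. Qed.

Let L0_le_refl : reflexive L0_le.
Proof. by elim/L0_ind=> f; apply/L0_leP; exact: vmeasure_aeW. Qed.

Let L0_le_anti : antisymmetric L0_le.
Proof.
elim/L0_ind=> f; elim/L0_ind=> g /andP[/L0_leP fg /L0_leP gf]; apply/L0_eqP.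
by apply: vmeasure_ae_imply2 fg gf => x fg gf; apply/eqP; rewrite eq_le fg.
Qed.

Let L0_le_trans : transitive L0_le.
Proof.
elim/L0_ind=> g; elim/L0_ind=> f; elim/L0_ind=> h /L0_leP fg /L0_leP gh.
by apply/L0_leP; apply: vmeasure_ae_imply2 fg gh => x; exact: le_trans.
Qed.

HB.instance Definition _ := Order.Le_isPOrder.Build ring_display L0
  L0_le_refl L0_le_anti L0_le_trans.

Lemma pi_L0_leP f g :
  reflect (vmeasure_ae mu (fun x => f x <= g x)) (\pi_L0 f <= \pi_L0 g :> L0).
Proof. exact: L0_leP. Qed.

Let L0_joinP (u v w : L0) : (L0_join u v <= w) = (u <= w) && (v <= w).
Proof.
elim/L0_ind: u => f; elim/L0_ind: v => g; elim/L0_ind: w => h; rewrite L0_joinE.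
apply/pi_L0_leP/andP => [fgh|[/pi_L0_leP fh /pi_L0_leP gh]].
  by split; apply/pi_L0_leP; apply: vmeasure_ae_imply fgh => x /=;
    rewrite ge_max => /andP[].
by apply: vmeasure_ae_imply2 fh gh => x /= fh gh; rewrite ge_max fh.
Qed.

Let L0_meetP (u v w : L0) : (w <= L0_meet u v) = (w <= u) && (w <= v).
Proof.
elim/L0_ind: u => f; elim/L0_ind: v => g; elim/L0_ind: w => h; rewrite L0_meetE.
apply/pi_L0_leP/andP => [fgh|[/pi_L0_leP fh /pi_L0_leP gh]].
  by split; apply/pi_L0_leP; apply: vmeasure_ae_imply fgh => x /=;
    rewrite le_min => /andP[].
by apply: vmeasure_ae_imply2 fh gh => x /= fh gh; rewrite le_min fh.
Qed.

Let L0_levD2r (w u v : L0) : u <= v -> u + w <= v + w.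
Proof.
elim/L0_ind: u => f; elim/L0_ind: v => g; elim/L0_ind: w => h /pi_L0_leP fg.
rewrite -!pi_L0D; apply/pi_L0_leP; apply: vmeasure_ae_imply fg => x fgx.
by rewrite !mfunD /= lerD2r.
Qed.

Let L0_scalev_ge0 (a : R) (u : L0) : 0 <= a -> 0 <= u -> 0 <= a *: u.
Proof.
elim/L0_ind: u => f a0 /pi_L0_leP f0; rewrite -pi_L0Z; apply/pi_L0_leP.
by apply: vmeasure_ae_imply f0 => x f0; exact: mulr_ge0 a0 f0.
Qed.

Lemma pi_L0Mn f n : \pi_L0 (f *+ n) = \pi_L0 f *+ n :> L0.
Proof. by elim: n => [//|n IH]; rewrite !mulrS pi_L0D IH. Qed.

Let L0_archimedean (u v : L0) :
  0 <= u -> (forall n : nat, u *+ n <= v) -> u = 0.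
Proof.
elim/L0_ind: u => f; elim/L0_ind: v => g /pi_L0_leP f0 fg; apply/L0_eqP.
have /vmeasure_ae_all fg' :
    forall n : nat, vmeasure_ae mu (fun x => f x *+ n <= g x).
  move=> n; have := fg n; rewrite -pi_L0Mn => /pi_L0_leP.
  by apply: vmeasure_ae_imply => x; rewrite mfunMn.
by apply: vmeasure_ae_imply2 f0 fg' => x; exact: real_archimedean.
Qed.

HB.instance Definition _ := POrderedLmodule_isVectorLattice.Build R L0
  L0_joinP L0_meetP L0_levD2r L0_scalev_ge0 L0_archimedean.

Let L0_mulA : associative L0_mul.
Proof.
by elim/L0_ind=> f; elim/L0_ind=> g; elim/L0_ind=> h; rewrite !L0_mulE mulrA.
Qed.

Let L0_mulDl (u v w : L0) : L0_mul (u + v) w = L0_mul u w + L0_mul v w.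
Proof.
elim/L0_ind: u => f; elim/L0_ind: v => g; elim/L0_ind: w => h.
by rewrite -pi_L0D !L0_mulE mulrDl pi_L0D.
Qed.

Let L0_mulDr (u v w : L0) : L0_mul u (v + w) = L0_mul u v + L0_mul u w.
Proof.
elim/L0_ind: u => f; elim/L0_ind: v => g; elim/L0_ind: w => h.
by rewrite -pi_L0D !L0_mulE mulrDr pi_L0D.
Qed.

Let L0_mulZl (a : R) (u v : L0) : L0_mul (a *: u) v = a *: L0_mul u v.
Proof.
elim/L0_ind: u => f; elim/L0_ind: v => g.
by rewrite -pi_L0Z !L0_mulE -pi_L0Z -[f * g]/(f ** g) -vmulZl.
Qed.

Let L0_mulZr (a : R) (u v : L0) : L0_mul u (a *: v) = a *: L0_mul u v.
Proof.
elim/L0_ind: u => f; elim/L0_ind: v => g.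
by rewrite -pi_L0Z !L0_mulE -pi_L0Z -[f * g]/(f ** g) -vmulZr.
Qed.

Let L0_mul_ge0 (u v : L0) : 0 <= u -> 0 <= v -> 0 <= L0_mul u v.
Proof.
elim/L0_ind: u => f; elim/L0_ind: v => g /pi_L0_leP f0 /pi_L0_leP g0.
rewrite L0_mulE; apply/pi_L0_leP; apply: vmeasure_ae_imply2 f0 g0 => x f0 g0.
exact: mulr_ge0 f0 g0.
Qed.

HB.instance Definition _ := VectorLattice_isVLAlgebra.Build R L0
  L0_mulA L0_mulDl L0_mulDr L0_mulZl L0_mulZr L0_mul_ge0.

(* Since [calN mu] is contained in [calL1 mu], the classes of [calL1 mu] modulo
   [calN mu] are the classes in [L0] with a representative in [calL1 mu]. *)
Definition L1 : set L0 := [set \pi_L0 f | f in calL1 mu].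

Definition Imu_L1 (u : L0) : V := Imu mu (repr u).

End L0.
Arguments L1 {dX X R V} mu.
Arguments Imu_L1 {dX X R V} mu u.

(* Main.v *)
(* Multiplication on both sides by an idempotent p with 0 <= p <= e is a
   positive idempotent operator below the identity, hence a band projection;
   this gives the statement on mu(X)A mu(X).
   Spectrality makes the integral multiplicative on simple functions, and the
   monotone continuity of the multiplication carries this over to L^1 and yields
   the monotone convergence theorem.  For an integrable f, the integrals of f^+
   and f^- are supported by mu(D) and mu(X \ D) with D = {f >= 0}; these are
   orthogonal elements below e, so the two integrals are disjoint and I_mu is a
   lattice homomorphism.  It vanishes only on null functions.
   If A is monotone complete with the countable sup property, the integrals of a
   bounded increasing net in L^1 have the same supremum as those along some
   sequence.  The supremum w of that sequence dominates the whole net: joining w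
   with a member of the net does not change its integral, and I_mu is injective
   on L^1. *)
Require Import Defs.
From HB Require Import structures.
From mathcomp Require Import all_boot all_order all_algebra.
From mathcomp Require Import generic_quotient.
From mathcomp Require Import all_classical all_reals all_analysis.
From mathcomp Require Import measurable_realfun lra.

Set Implicit Arguments.
Unset Strict Implicit.
Unset Printing Implicit Defensive.

Import Order.TTheory GRing.Theory Num.Theory.
Import numFieldNormedType.Exports.
Import HBNNSimple.

Local Open Scope classical_set_scope.
Local Open Scope ring_scope.
Local Open Scope quotient_scope.

(** * Vector lattices *)

(** The integral is read off one arbitrarily chosen approximating sequence, so the crux is that the
    choice does not matter. In [A] there is no epsilon to add: the slack between a simple function
    and its approximants is multiplicative, a factor (k+2)/(k+1), and the Archimedean property
    removes it. The sets on which the approximation is already good increase to [X], and integrating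
    over such a set amounts to multiplying by its measure. So spectrality and continuity of the
    multiplication enter at the very foundation of the integral, and the same argument, run for
    nonnegative measurable functions instead of simple ones, is monotone convergence. In the
    quotient, suprema are computed pointwise on representatives. This works for sequences, since
    countably many null sets can be discarded at once, but not for general nets; hence the detour
    through a sequence selected in [A]. *)

Section VectorLatticeTheory.
Context {R : realType} {V : vectLatticeType R}.
Implicit Types (x y z t a b : V) (u v : nat -> V).

Lemma lev_add2r z x y : (x + z <= y + z) = (x <= y).
Proof.
apply/idP/idP => [xy|]; last exact: levD2r.
by rewrite -(addrK z x) -(addrK z y); exact: levD2r.
Qed.

Lemma lev_add2l z x y : (z + x <= z + y) = (x <= y).
Proof. by rewrite ![z + _]addrC lev_add2r. Qed.

Lemma lev_add x y z t : x <= y -> z <= t -> x + z <= y + t.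
Proof.
move=> xy zt; apply: (@le_trans _ _ (y + z)); first by rewrite lev_add2r.
by rewrite lev_add2l.
Qed.

Lemma lev_subl_addr x y z : (x - y <= z) = (x <= z + y).
Proof. by rewrite -(lev_add2r y (x - y)) subrK. Qed.

Lemma lev_subr_addr x y z : (x <= z - y) = (x + y <= z).
Proof. by rewrite -(lev_add2r y x (z - y)) subrK. Qed.

Lemma subv_ge0 x y : (0 <= y - x) = (x <= y).
Proof. by rewrite lev_subr_addr add0r. Qed.

Lemma lev_opp2 x y : (- x <= - y) = (y <= x).
Proof. by rewrite -(subv_ge0 (- x)) opprK addrC subv_ge0. Qed.

Lemma addv_ge0 x y : 0 <= x -> 0 <= y -> 0 <= x + y.
Proof. by move=> x0 y0; rewrite -[0]addr0; exact: lev_add. Qed.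

Lemma lev_addl x y : 0 <= y -> x <= x + y.
Proof. by move=> y0; rewrite -[leLHS]addr0 lev_add2l. Qed.

Lemma lev_subl x y : 0 <= y -> x - y <= x.
Proof. by move=> y0; rewrite lev_subl_addr; exact: lev_addl. Qed.

Lemma lev_scale (c : R) x y : 0 <= c -> x <= y -> c *: x <= c *: y.
Proof.
move=> c0 xy.
by rewrite -(subv_ge0 (c *: x)) -scalerBr scalev_ge0// subv_ge0.
Qed.

Lemma lev_sum (I : Type) (r : seq I) (F G : I -> V) :
  (forall i, F i <= G i) -> \sum_(i <- r) F i <= \sum_(i <- r) G i.
Proof.
move=> FG; elim/big_ind2 : _ => // x1 x2 y1 y2; exact: lev_add.
Qed.

Lemma vjoin_ubl x y : x <= vjoin x y.
Proof. by have := lexx (vjoin x y); rewrite vjoinP => /andP[]. Qed.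

Lemma vjoin_ubr x y : y <= vjoin x y.
Proof. by have := lexx (vjoin x y); rewrite vjoinP => /andP[]. Qed.

Lemma vjoin_lub x y z : x <= z -> y <= z -> vjoin x y <= z.
Proof. by rewrite vjoinP => -> ->. Qed.

Lemma vmeet_lbl x y : vmeet x y <= x.
Proof. by have := lexx (vmeet x y); rewrite vmeetP => /andP[]. Qed.

Lemma vmeet_lbr x y : vmeet x y <= y.
Proof. by have := lexx (vmeet x y); rewrite vmeetP => /andP[]. Qed.

Lemma vmeet_glb x y z : z <= x -> z <= y -> z <= vmeet x y.
Proof. by rewrite vmeetP => -> ->. Qed.

Lemma vjoin_unique x y s :
  (forall z, (s <= z) = (x <= z) && (y <= z)) -> s = vjoin x y.
Proof.
by move=> sP; apply/eqP; rewrite eq_le sP vjoin_ubl vjoin_ubr vjoinP -sP lexx.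
Qed.

Lemma vmeet_unique x y s :
  (forall z, (z <= s) = (z <= x) && (z <= y)) -> s = vmeet x y.
Proof.
move=> sP; apply/eqP; rewrite eq_le sP vmeet_lbl vmeet_lbr vmeetP -sP lexx.
by [].
Qed.

Lemma vjoinDr x y z : vjoin x y + z = vjoin (x + z) (y + z).
Proof. by apply: vjoin_unique => t; rewrite -!lev_subr_addr vjoinP. Qed.

Lemma vjoinC x y : vjoin x y = vjoin y x.
Proof. by apply: vjoin_unique => t; rewrite vjoinP andbC. Qed.

(** The map sending [z] to [x + y - z] reverses the order and swaps [x] and [y], so it turns their
    supremum into their infimum. *)
Lemma vjoin_meetE x y : vmeet x y = x + y - vjoin x y.
Proof.
apply/esym/vmeet_unique => z.
rewrite lev_subr_addr addrC -lev_subr_addr vjoinP !lev_subr_addr andbC.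
by rewrite lev_add2l [y + z]addrC lev_add2r.
Qed.

Definition vpos x := vjoin x 0.

Lemma vpos_ge0 x : 0 <= vpos x. Proof. exact: vjoin_ubr. Qed.

Lemma vpos_ge x : x <= vpos x. Proof. exact: vjoin_ubl. Qed.

Lemma vpos_subE x : vpos x - vpos (- x) = x.
Proof.
apply/eqP; rewrite subr_eq addrC; apply/eqP.
by rewrite /vpos vjoinDr addNr add0r vjoinC.
Qed.

(** Reduces the preservation of joins to linearity and positive parts, both for band projections and
    for the integral. *)
Lemma vjoin_vpos x y : vjoin x y = y + vpos (x - y).
Proof. by rewrite addrC /vpos vjoinDr subrK add0r. Qed.

(** Disjointness gives [a + b = vjoin a b]; translating by [- b] turns this join into the positive
    part of [a - b]. *)
Lemma vpos_disjoint a b : vmeet a b = 0 -> vpos (a - b) = a.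
Proof.
rewrite vjoin_meetE => /eqP; rewrite subr_eq0 => /eqP ab.
by rewrite -{2}(addrK b a) ab /vpos -(subrr b) -vjoinDr.
Qed.

Lemma vabs_ub x : x <= vabs x. Proof. exact: vjoin_ubl. Qed.

(** The sum of [x] and [- x] bounds twice the modulus from below by [0]; then halve. *)
Lemma vabs_ge0 x : 0 <= vabs x.
Proof.
have h : 0 <= vabs x + vabs x.
  by rewrite -(subrr x); apply: lev_add; [exact: vjoin_ubl|exact: vjoin_ubr].
have -> : vabs x = 2^-1 *: (vabs x + vabs x).
  rewrite -mulr2n -(scaler_nat _ (vabs x)) scalerA.
  by rewrite mulVf ?scale1r// pnatr_eq0.
by apply: scalev_ge0.
Qed.

Lemma vpos_le_vabs x : vpos x <= vabs x.
Proof. by apply: vjoin_lub; [exact: vjoin_ubl|exact: vabs_ge0]. Qed.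

Lemma vabsN x : vabs (- x) = vabs x.
Proof. by rewrite /vabs opprK vjoinC. Qed.

Lemma vabs_pos x : 0 <= x -> vabs x = x.
Proof.
move=> x0; apply/eqP; rewrite eq_le vabs_ub andbT vjoinP lexx.
by apply: (le_trans _ x0); rewrite -oppr0 lev_opp2.
Qed.

Lemma vabs_le_pos x : vabs x <= vpos x + vpos (- x).
Proof.
apply: vjoin_lub.
  by apply: (le_trans (vpos_ge x)); apply: lev_addl; exact: vpos_ge0.
by rewrite addrC; apply: (le_trans (vpos_ge _)); apply/lev_addl/vpos_ge0.
Qed.

(** The Archimedean axiom concerns positive elements, so it is applied to [vpos x]. Dividing by
    [n.+1] first lets the bound on [vpos x] split into one for [x] and one for [0]. *)
Lemma archimedean_le0 x b : (forall n : nat, x *+ n <= b) -> x <= 0.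
Proof.
move=> xb; suff <- : vpos x = 0 by exact: vpos_ge.
apply: (@vlat_archimedean _ _ (vpos x) (vpos b)) (vpos_ge0 x) _.
case=> [|n]; first by rewrite mulr0n vpos_ge0.
have n0 : 0 <= n.+1%:R^-1 :> R by rewrite invr_ge0.
suff : vpos x <= n.+1%:R^-1 *: vpos b.
  move=> /(lev_scale (ler0n R n.+1)).
  by rewrite scalerA mulfV// scale1r scaler_nat.
apply: vjoin_lub; last by apply: scalev_ge0 => //; exact: vpos_ge0.
have -> : x = n.+1%:R^-1 *: (x *+ n.+1).
  by rewrite -(scaler_nat _ x) scalerA mulVf// scale1r.
by apply: lev_scale => //; exact: le_trans (xb _) (vpos_ge b).
Qed.

Lemma sup_unique (D S : set V) a b : sup_in D S a -> sup_in D S b -> a = b.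
Proof.
move=> [Da ua la] [Db ub lb]; apply/eqP.
by rewrite eq_le la// lb.
Qed.

Lemma sup_same_ub (S T : set V) a : (forall b, ubound S b <-> ubound T b) ->
  sup_in [set: V] S a -> sup_in [set: V] T a.
Proof.
by move=> ST [_ uS lS]; split => // [|b _ /ST]; [exact/ST|exact: lS].
Qed.

Lemma ubound_range (I : Type) (w : I -> V) b :
  ubound (range w) b <-> forall i, w i <= b.
Proof.
by split=> [wb i|wb _ [i _ <-] //]; apply: wb; exists i.
Qed.

Lemma sup_range_ub (D : set V) (I : Type) (w : I -> V) s i :
  sup_in D (range w) s -> w i <= s.
Proof. by move=> [_ /ubound_range]. Qed.

Lemma sup_range_le (I : Type) (w : I -> V) s b :
  sup_in [set: V] (range w) s -> (forall i, w i <= b) -> s <= b.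
Proof. by move=> [_ _ h] wb; apply: h => //; exact/ubound_range. Qed.

Lemma sup_rangeI (I : Type) (w : I -> V) s : (forall i, w i <= s) ->
  (forall b, (forall i, w i <= b) -> s <= b) -> sup_in [set: V] (range w) s.
Proof.
by move=> h1 h2; split => //; [exact/ubound_range|move=> b _ /ubound_range /h2].
Qed.

(** Subtraction moves one summand at a time across the inequality, so the two suprema are taken one
    after the other. *)
Lemma sup_add_le (I J : Type) (u : I -> V) (v : J -> V) s t b :
  sup_in [set: V] (range u) s -> sup_in [set: V] (range v) t ->
  (forall i j, u i + v j <= b) -> s + t <= b.
Proof.
move=> us vt uvb; rewrite addrC -lev_subr_addr; apply: (sup_range_le vt) => j.
rewrite lev_subr_addr addrC -lev_subr_addr; apply: (sup_range_le us) => i.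
by rewrite lev_subr_addr.
Qed.

End VectorLatticeTheory.

(** * Vector lattice algebras and band projections *)

Section VectorLatticeAlgebraTheory.
Context {R : realType} {A : vlAlgType R}.
Implicit Types (x y z a b c p e : A).

Lemma vmulBl x y z : (x - y) ** z = x ** z - y ** z.
Proof. by rewrite -scaleN1r vmulDl vmulZl scaleN1r. Qed.

Lemma vmulBr x y z : x ** (y - z) = x ** y - x ** z.
Proof. by rewrite -scaleN1r vmulDr vmulZr scaleN1r. Qed.

Lemma vmul0l x : 0 ** x = 0.
Proof. by rewrite -(subrr 0) vmulBl !subrr. Qed.

Lemma vmul0r x : x ** 0 = 0.
Proof. by rewrite -(subrr 0) vmulBr !subrr. Qed.

Lemma lev_mul2l c x y : 0 <= c -> x <= y -> c ** x <= c ** y.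
Proof. by move=> c0 xy; rewrite -subv_ge0 -vmulBr vmul_ge0// subv_ge0. Qed.

Lemma lev_mul2r c x y : 0 <= c -> x <= y -> x ** c <= y ** c.
Proof. by move=> c0 xy; rewrite -subv_ge0 -vmulBl vmul_ge0// subv_ge0. Qed.

Lemma lev_mul x y z t :
  0 <= x -> 0 <= t -> x <= y -> z <= t -> x ** z <= y ** t.
Proof.
move=> x0 t0 xy zt; apply: (@le_trans _ _ (x ** t)); first exact: lev_mul2l.
exact: lev_mul2r.
Qed.

Lemma vmul_sup_le (u v : nat -> A) s t b :
  sigma_monotone_continuous_mul A ->
  {homo u : m n / (m <= n)%N >-> m <= n} ->
  {homo v : m n / (m <= n)%N >-> m <= n} ->
  (forall n, 0 <= u n) -> (forall n, 0 <= v n) ->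
  sup_in [set: A] (range u) s -> sup_in [set: A] (range v) t ->
  (forall m n, u m ** v n <= b) -> s ** t <= b.
Proof.
move=> cont uM vM u0 v0 us vt uvb.
have s0 : 0 <= s by exact: le_trans (u0 0%N) (sup_range_ub 0%N us).
have t0 : 0 <= t by exact: le_trans (v0 0%N) (sup_range_ub 0%N vt).
have [[_ svt] _] : seq_up [set: A] (fun n => s ** v n) (s ** t) /\ _ :=
  cont v t v0 t0 (conj vM vt) s s0.
apply: (sup_range_le svt) => n.
have [_ [_ usv]] := cont u s u0 s0 (conj uM us) (v n) (v0 n).
exact: (sup_range_le usv).
Qed.

End VectorLatticeAlgebraTheory.

(** * Positive linear idempotents below the identity are band projections *)

Section BandProjection.
Context {R : realType} {V : vectLatticeType R} (P : V -> V).
Context (P_linear : forall (a : R) x y, P (a *: x + y) = a *: P x + P y).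
Context (P_ge0 : forall x, 0 <= x -> 0 <= P x).
Context (P_le : forall x, 0 <= x -> P x <= x).
Context (P_idem : forall x, P (P x) = P x).
Implicit Types (x y z : V).

Let PB x y : P (x - y) = P x - P y.
Proof. by rewrite addrC -scaleN1r P_linear scaleN1r addrC. Qed.

Let P0 : P 0 = 0.
Proof. by rewrite -(subrr 0) PB !subrr. Qed.

Let P_mono x y : x <= y -> P x <= P y.
Proof. by move=> xy; rewrite -subv_ge0 -PB P_ge0// subv_ge0. Qed.

Lemma range_proj x : range P x <-> P x = x.
Proof. by split=> [[y _ <-]|xP]; [exact: P_idem|exists x]. Qed.

Let fixD x y : P x = x -> P y = y -> P (x + y) = x + y.
Proof. by move=> xP yP; rewrite -[x]scale1r P_linear xP yP. Qed.

(** Besides [P z <= z] one has [P (y - z) <= y - z], which with [P y = y] is the reverse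
    inequality. *)
Let fix_solid z y : 0 <= z -> z <= y -> P y = y -> P z = z.
Proof.
move=> z0 zy yP; apply/eqP; rewrite eq_le P_le//=.
have : 0 <= y - z by rewrite subv_ge0.
by move=> /P_le; rewrite PB yP lev_subl_addr addrAC lev_subr_addr lev_add2l.
Qed.

Let fix_pos y : P y = y -> P (vpos y) = vpos y.
Proof.
move=> yP; apply/eqP; rewrite eq_le P_le ?vpos_ge0//=.
apply: vjoin_lub; last exact/P_ge0/vpos_ge0.
by rewrite -[leLHS]yP; exact/P_mono/vpos_ge.
Qed.

Let fixN y : P y = y -> P (- y) = - y.
Proof. by move=> yP; rewrite -sub0r PB P0 yP. Qed.

(** The element [vpos y + vpos (- y)] is fixed and dominates the positive and the negative part of
    [x], so [fix_solid] applies to each of them. *)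
Let fix_abs_solid x y : P y = y -> vabs x <= vabs y -> P x = x.
Proof.
move=> yP xy.
have yb : P (vpos y + vpos (- y)) = vpos y + vpos (- y).
  by apply: fixD; apply: fix_pos => //; exact: fixN.
have h z : vabs z = vabs x -> P (vpos z) = vpos z.
  move=> zx; apply: fix_solid (vpos_ge0 z) _ yb.
  apply: le_trans (vpos_le_vabs z) _; rewrite zx; apply: le_trans xy _.
  exact: vabs_le_pos.
by rewrite -(vpos_subE x) PB !h ?vabsN.
Qed.

Lemma range_proj_linear : linear_subspace (range P).
Proof.
split=> [|a x y /range_proj xP /range_proj yP]; first exact/range_proj.
by apply/range_proj; rewrite P_linear xP yP.
Qed.

Lemma range_proj_ideal : order_ideal_in [set: V] (range P).
Proof.
split=> // [|x y _ /range_proj yP xy]; first exact: range_proj_linear.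
by apply/range_proj; exact: fix_abs_solid xy.
Qed.

Lemma range_proj_sublattice : vector_sublattice (range P).
Proof.
split; first exact: range_proj_linear.
move=> x y /range_proj xP /range_proj yP.
have jP : P (vjoin x y) = vjoin x y.
  rewrite vjoin_vpos; apply: fixD => //; apply: fix_pos.
  by apply: fixD => //; exact: fixN.
split; apply/range_proj => //.
by rewrite vjoin_meetE; apply: fixD; [exact: fixD|exact: fixN].
Qed.

(** Monotonicity makes [P s] an upper bound of [S], whence [s <= P s]. The reverse inequality comes
    from [P (s - x) <= s - x] for one [x] in [S]. *)
Let fix_sup S s : S `<=` range P -> sup_in [set: V] S s -> P s = s.
Proof.
move=> SP [_ Ss ls].
have sPs : s <= P s.
  by apply: ls => // x Sx; have /range_proj <- := SP _ Sx; exact/P_mono/Ss.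
have [[x Sx]|S0] := pselect (exists x, S x).
  have /range_proj xP := SP _ Sx.
  have : 0 <= s - x by rewrite subv_ge0; exact: Ss.
  move=> /P_le; rewrite PB xP lev_add2r => Pss.
  by apply/eqP; rewrite eq_le sPs Pss.
(* The definition of a band admits an empty [S]. Its supremum would be a least element of the space,
   and comparing it with [s + s] and with [0] leaves only [s = 0]. *)
have s_le z : s <= z by apply: ls => // x Sx; case: S0; exists x.
have s0 : 0 <= s by have := s_le (s + s); rewrite -[leLHS]addr0 lev_add2l.
have -> : s = 0 by apply/eqP; rewrite eq_le s0 s_le.
exact: P0.
Qed.

(** The decomposition is [x = P x + (x - P x)]. A meet [z] of the moduli of [x - P x] and of a fixed
    [y] is itself fixed by solidity, and lies below [vabs x - P (vabs x)], which [P] sends to [0];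
    hence [z = P z <= 0]. *)
Lemma range_proj_band : projection_band (range P).
Proof.
split.
  split; first exact: range_proj_ideal.
  by move=> S s SP sS; apply/range_proj; exact: fix_sup sS.
move=> x; exists (P x), (x - P x); split; last by rewrite addrC subrK.
  by exists x.
move=> y /range_proj yP.
set z := vmeet _ _.
have z0 : 0 <= z by apply: vmeet_glb; exact: vabs_ge0.
have yabsP : P (vabs y) = vabs y.
  by apply: fix_abs_solid yP _; rewrite (vabs_pos (vabs_ge0 y)).
have zP : P z = z by apply: fix_solid z0 _ yabsP; exact: vmeet_lbr.
apply/eqP; rewrite eq_le z0 andbT -zP.
have h t : t <= vabs x -> t - P t <= vabs x - P (vabs x).
  move=> tx; have : 0 <= vabs x - t by rewrite subv_ge0.
  by move=> /P_le; rewrite PB !lev_subr_addr [t - _ + _]addrC addrA addrAC.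
have <- : P (vabs x - P (vabs x)) = 0 by rewrite PB P_idem subrr.
apply: P_mono; apply: le_trans (vmeet_lbl _ _) _.
apply: vjoin_lub; first by apply: h; exact: vabs_ub.
have -> : - (x - P x) = - x - P (- x) 
  by rewrite -[in P (- x)]sub0r PB P0 sub0r opprB opprK addrC.
by apply: h; exact: vjoin_ubr.
Qed.

End BandProjection.

(** * The corner of an idempotent between [0] and the identity *)

Section Corner.
Context {R : realType} {A : vlAlgType R} (p e : A).
Context (e_identity : is_identity [set: A] e).
Context (p_ge0 : 0 <= p) (p_le_e : p <= e) (p_idem : p ** p = p).
Implicit Types (x y : A).

Lemma corner_proj_le x : 0 <= x -> p ** x ** p <= x.
Proof.
move=> x0; have [_ eP] := e_identity; have [ex xe] := eP x I.
apply: (@le_trans _ _ (p ** x)).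
  have [_ {2}<-] := eP (p ** x) I.
  by apply: lev_mul2l => //; exact: vmul_ge0.
by rewrite -[leRHS]ex; exact: lev_mul2r.
Qed.

Lemma corner_proj_linear (a : R) x y :
  p ** (a *: x + y) ** p = a *: (p ** x ** p) + p ** y ** p.
Proof. by rewrite vmulDr vmulDl vmulZr vmulZl. Qed.

Lemma corner_proj_idem x : p ** (p ** x ** p) ** p = p ** x ** p.
Proof. by rewrite !vmulA p_idem -!vmulA p_idem. Qed.

Let corner_proj_ge0 x : 0 <= x -> 0 <= p ** x ** p.
Proof. by move=> x0; do 2 apply: vmul_ge0 => //. Qed.

Lemma cornerP x : corner p x <-> p ** x ** p = x.
Proof. exact: range_proj corner_proj_idem x. Qed.

Lemma corner_subalgebra : vl_subalgebra (corner p).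
Proof.
split.
  apply: range_proj_sublattice.
  - exact: corner_proj_linear.
  - exact: corner_proj_ge0.
  - exact: corner_proj_le.
  - exact: corner_proj_idem.
move=> x y /cornerP xp /cornerP yp; apply/cornerP.
by rewrite -xp -yp !vmulA p_idem -!vmulA p_idem.
Qed.

Lemma corner_projection_band : projection_band (corner p).
Proof.
apply: range_proj_band.
- exact: corner_proj_linear.
- exact: corner_proj_ge0.
- exact: corner_proj_le.
- exact: corner_proj_idem.
Qed.

(* Multiplication by [q] is the band projection onto the band generated by [q],
   so a common lower bound of orthogonal [q] and [r] satisfies z = qz = qrz. *)
Lemma disjoint_le_orthogonal q r x y z :
  0 <= q -> q <= e -> 0 <= r -> r <= e -> r ** q = 0 -> x ** q = x ->
  y ** r = y -> 0 <= z -> z <= x -> z <= y -> z = 0.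
Proof.
move=> q0 qe r0 re rq xq yr z0 zx zy; have [_ eP] := e_identity.
(* Right multiplication by [e - s] is positive and kills [w], hence it kills every element between
   [0] and [w]. *)
have h s w : s <= e -> w ** s = w -> z <= w -> z = z ** s.
  move=> se ws zw; have [_ ze] := eP z I; have [_ we] := eP w I.
  have es : 0 <= e - s by rewrite subv_ge0.
  apply/eqP; rewrite -subr_eq0 -{1}ze -vmulBr eq_le vmul_ge0// andbT.
  apply: le_trans (lev_mul2r es zw) _.
  by rewrite vmulBr ws we subrr.
by rewrite (h q x)// (h r y)// -vmulA rq vmul0r.
Qed.

End Corner.

(** * Simple integrals *)

Section SimpleIntegral.
Context {dX : measure_display} {X : measurableType dX} {R : realType}.
Context {V : vectLatticeType R} (mu : vmeasure X V).
Implicit Types (D E : set X) (phi psi chi : {nnsfun X >-> R}).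

(** Along [D], [E], [set0], [set0], ... the partial sums are [mu D + mu E] from the second one on,
    and the first is smaller by positivity. *)
Lemma vmeasureU D E : measurable D -> measurable E -> D `&` E = set0 ->
  mu (D `|` E) = mu D + mu E.
Proof.
move=> mD mE DE.
have mF n : measurable (bigcup2 D E n) by case: n => [|[|n]] //=.
have tF : trivIset [set: nat] (bigcup2 D E) by rewrite -trivIset_bigcup2.
have := vmeasure_sigma_additive mu mF tF; rewrite bigcup2E => supF.
apply: sup_unique supF _; apply: sup_rangeI => [[|n]|b h].
- by rewrite big_ord1 /=; apply/lev_addl/vmeasure_ge0.
- rewrite 2!big_ord_recl /= big1 ?addr0// => i _; exact: vmeasure0.
- by have := h 1%N; rewrite big_ord_recl big_ord1.
Qed.

Lemma vmeasure_le D E : measurable D -> measurable E -> D `<=` E ->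
  mu D <= mu E.
Proof.
move=> mD mE DE; rewrite -(setDUK DE) vmeasureU//.
- by apply/lev_addl/vmeasure_ge0/measurableD.
- exact: measurableD.
- by rewrite setDE setICA setICr setI0.
Qed.

Lemma vmeasure_partition (T : eqType) (h : X -> T) (s : seq T) D :
  measurable D -> uniq s ->
  (forall t, t \in s -> measurable (h @^-1` [set t])) ->
  mu (D `&` h @^-1` [set` s]) = \sum_(t <- s) mu (D `&` h @^-1` [set t]).
Proof.
move=> mD + ms.
(* The induction runs over lists contained in [s], whose level sets are known to be measurable, and
   carries along the measurability that finite additivity asks of the union. *)
suff : forall r : seq T, {subset r <= s} -> uniq r ->
    measurable (h @^-1` [set` r]) /\
    mu (D `&` h @^-1` [set` r]) = \sum_(t <- r) mu (D `&` h @^-1` [set t]).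
  by move=> /(_ s) H /H[].
elim=> [_ _|t r IH trs /=/andP[tr ur]].
  have -> : h @^-1` [set` [::]] = set0 by rewrite -subset0 => x.
  by rewrite big_nil setI0 vmeasure0.
have [|mr IHr] := IH _ ur.
  by move=> x xr; apply: trs; rewrite inE xr orbT.
have mt : measurable (h @^-1` [set t]).
  by apply: ms; apply: trs; rewrite mem_head.
have -> : h @^-1` [set` t :: r] = h @^-1` [set t] `|` h @^-1` [set` r].
  apply/seteqP; split => x /=.
    by rewrite inE => /orP[/eqP|]; [left|right].
  by move=> [->|hr]; rewrite inE ?eqxx ?hr ?orbT.
rewrite big_cons; split; first exact: measurableU.
rewrite setIUr vmeasureU ?IHr//; [exact: measurableI|exact: measurableI|].
rewrite -subset0 => x [[_ /= xt] [_ /= xr]].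
by move: tr; rewrite -xt xr.
Qed.

(** The measures of the successive differences [seqD E] telescope to [mu (E N)], so this is
    sigma-additivity. *)
Lemma vmeasure_continuous_below (E : nat -> set X) :
  (forall n, measurable (E n)) -> nondecreasing_seq E ->
  sup_in [set: V] (range (mu \o E)) (mu (\bigcup_n E n)).
Proof.
move=> mE ndE.
have mD n : measurable (seqD E n) by case: n => [|n] //=; exact: measurableD.
have muE N : \sum_(n < N.+1) mu (seqD E n) = mu (E N).
  elim: N => [|N IH]; first by rewrite big_ord1.
  rewrite big_ord_recr /= IH -vmeasureU//; [|exact: measurableD|].
    by rewrite setDUK//; apply/subsetPset/ndE.
  by rewrite setDE setICA setICr setI0.
have := vmeasure_sigma_additive mu mD (trivIset_seqD ndE).
by rewrite eq_bigcup_seqD (funext muE).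
Qed.

Definition values phi : seq R := finmap.enum_fset (fset_set (range phi)).

Lemma in_values phi : values phi =i range phi.
Proof. by move=> r; rewrite -in_fset_set. Qed.

Lemma mem_values phi x : phi x \in values phi.
Proof. by rewrite in_values inE; exists x. Qed.

Lemma uniq_values phi : uniq (values phi).
Proof. exact: finmap.fset_uniq. Qed.

Lemma measurable_level phi r : measurable (phi @^-1` [set r]).
Proof. exact: measurable_funPTI. Qed.

(** Any finite measurable partition on whose cells [phi] is constant computes the integral: cut the
    level sets of [phi] along [h], exchange the sums, and on the cell of [t] only the value [c t]
    survives. The labels are arbitrary so that pairs of reals and booleans can serve. *)
Lemma sintegral_vm_refine (T : eqType) (h : X -> T) (s : seq T) (c : T -> R)
    phi : uniq s -> (forall x, h x \in s) ->
  (forall t, t \in s -> measurable (h @^-1` [set t])) ->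
  (forall x, phi x = c (h x)) ->
  sintegral_vm mu phi = \sum_(t <- s) c t *: mu (h @^-1` [set t]).
Proof.
move=> us hs ms phic; rewrite /sintegral_vm fsbig_finite//=.
rewrite -/(values phi).
transitivity (\sum_(r <- values phi) \sum_(t <- s)
    r *: mu (phi @^-1` [set r] `&` h @^-1` [set t])).
  apply: eq_bigr => r _; rewrite -scaler_sumr -vmeasure_partition//.
  congr (_ *: mu _); apply/esym/setIidPl => x _ /=; exact: hs.
rewrite exchange_big /= big_seq [RHS]big_seq; apply: eq_bigr => t ts.
(* For a label that is not attained, [c t] need not be a value of [phi]; its cell is empty and
   contributes zero. *)
have [[x xt]|h0] := pselect (exists x, h x = t); last first.
  have -> : h @^-1` [set t] = set0.
    by rewrite -subset0 => x xt; apply: h0; exists x.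
  by rewrite vmeasure0 scaler0 big1// => r _; rewrite setI0 vmeasure0 scaler0.
have ct : c t \in values phi by rewrite -xt -phic mem_values.
rewrite (bigD1_seq (c t))//= ?uniq_values// big1 ?addr0 => [|r rt].
  by congr (_ *: mu _); apply/setIidPr => y /= yt; rewrite phic yt.
rewrite (_ : _ `&` _ = set0) ?vmeasure0 ?scaler0//.
rewrite -subset0 => y [/= yr yt].
by move: rt; rewrite -yr phic yt eqxx.
Qed.

(** Over the joint level sets of [phi] and [psi], order and algebra of simple integrals become
    statements about coefficients. *)
Lemma sintegral_vm_pair phi psi chi (c : R -> R -> R) :
  (forall x, chi x = c (phi x) (psi x)) ->
  sintegral_vm mu chi = \sum_(r <- values phi) \sum_(s <- values psi)
    c r s *: mu (phi @^-1` [set r] `&` psi @^-1` [set s]).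
Proof.
move=> chic.
rewrite (@sintegral_vm_refine _ (fun x => (phi x, psi x))
  [seq (r, s) | r <- values phi, s <- values psi] (fun u => c u.1 u.2))//.
- rewrite big_allpairs; apply: eq_bigr => r _; apply: eq_bigr => s _ /=.
  congr (_ *: mu _); apply/seteqP; split => x /=; first by case.
  by move=> [-> ->].
- by apply: allpairs_uniq; rewrite ?uniq_values// => -[a b] [a' b'].
- by move=> x; apply: allpairs_f; exact: mem_values.
- move=> [r s] _; rewrite (_ : _ @^-1` _ =
      phi @^-1` [set r] `&` psi @^-1` [set s]).
    by apply: measurableI; exact: measurable_level.
  apply/seteqP; split => x /=; first by case.
  by move=> [-> ->].
Qed.

Lemma sintegral_vm_ge0 phi : 0 <= sintegral_vm mu phi.
Proof.
rewrite (@sintegral_vm_pair phi phi phi (fun r _ => r))//.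
rewrite big_seq; elim/big_ind : _ => //; first exact: addv_ge0.
move=> r; rewrite in_values inE => -[x _ <-].
elim/big_ind : _ => //; first exact: addv_ge0.
move=> s _; apply: scalev_ge0 => //; apply: vmeasure_ge0.
by apply: measurableI; exact: measurable_level.
Qed.

Lemma sintegral_vm_le phi psi : (forall x, phi x <= psi x) ->
  sintegral_vm mu phi <= sintegral_vm mu psi.
Proof.
move=> le; rewrite (@sintegral_vm_pair phi psi phi (fun r _ => r))//.
rewrite (@sintegral_vm_pair phi psi psi (fun _ s => s))//.
apply: lev_sum => r; apply: lev_sum => s.
(* The comparison [r <= s] is known only for cells that contain a point; the empty ones have measure
   zero. *)
have [[x [xr xs]]|h0] := pselect
    ((phi @^-1` [set r] `&` psi @^-1` [set s]) !=set0); last first.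
  rewrite (_ : _ `&` _ = set0) ?vmeasure0 ?scaler0//.
  by rewrite -subset0 => x hx; apply: h0; exists x.
rewrite -subv_ge0 -scalerBl scalev_ge0 ?vmeasure_ge0//.
  by rewrite subr_ge0 -xr -xs.
by apply: measurableI; exact: measurable_level.
Qed.

Lemma sintegral_vm_eq phi psi : phi =1 psi ->
  sintegral_vm mu phi = sintegral_vm mu psi.
Proof.
by move=> e; apply/eqP; rewrite eq_le !sintegral_vm_le// => x; rewrite e.
Qed.

Lemma sintegral_vmD phi psi :
  sintegral_vm mu (add_nnsfun phi psi) =
  sintegral_vm mu phi + sintegral_vm mu psi.
Proof.
rewrite (@sintegral_vm_pair phi psi (add_nnsfun phi psi) (fun r s => r + s))//.
rewrite (@sintegral_vm_pair phi psi phi (fun r _ => r))//.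
rewrite (@sintegral_vm_pair phi psi psi (fun _ s => s))//.
rewrite -big_split /=; apply: eq_bigr => r _.
by rewrite -big_split /=; apply: eq_bigr => s _; rewrite scalerDl.
Qed.

Lemma sintegral_vmZ phi (k : R) (k0 : 0 <= k) :
  sintegral_vm mu (scale_nnsfun phi k0) = k *: sintegral_vm mu phi.
Proof.
rewrite (@sintegral_vm_pair phi phi _ (fun r _ => k * r))//.
rewrite (@sintegral_vm_pair phi phi phi (fun r _ => r))//.
rewrite scaler_sumr; apply: eq_bigr => r _.
by rewrite scaler_sumr; apply: eq_bigr => s _; rewrite scalerA.
Qed.

Lemma sintegral_vm_indic D (mD : measurable D) :
  sintegral_vm mu (indic_nnsfun R mD) = mu D.
Proof.
rewrite (@sintegral_vm_refine _ (fun x => x \in D) [:: true; false]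
  (fun b => b%:R))//.
- rewrite big_cons big_seq1 scale1r scale0r addr0; congr (mu _).
  by apply/seteqP; split => x /=; [exact: set_mem|exact: mem_set].
- by move=> x; case: (x \in D).
- move=> [] _ /=.
    rewrite (_ : _ @^-1` _ = D)//.
    by apply/seteqP; split => x /=; [exact: set_mem|exact: mem_set].
  rewrite (_ : _ @^-1` _ = ~` D); first exact: measurableC.
  apply/seteqP; split => x /=; last exact: memNset.
  by move=> xD /mem_set; rewrite xD.
Qed.

End SimpleIntegral.

(** * Multiplicativity of the simple integral *)

Section SpectralSimpleIntegral.
Context {dX : measure_display} {X : measurableType dX} {R : realType}.
Context {A : vlAlgType R} (mu : vmeasure X A) (mu_spectral : spectral mu).
Implicit Types (phi psi : {nnsfun X >-> R}).

Lemma vmulv_suml (I : Type) (s : seq I) (F : I -> A) (a : A) :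
  (\sum_(i <- s) F i) ** a = \sum_(i <- s) F i ** a.
Proof.
by apply: (big_morph (fun b => b ** a)) => [x y|]; rewrite ?vmulDl ?vmul0l.
Qed.

Lemma vmulv_sumr (I : Type) (s : seq I) (F : I -> A) (a : A) :
  a ** (\sum_(i <- s) F i) = \sum_(i <- s) a ** F i.
Proof.
by apply: (big_morph (fun b => a ** b)) => [x y|]; rewrite ?vmulDr ?vmul0r.
Qed.

(** A joint level set is an intersection, whose measure spectrality splits into a product; the
    double sum then factors. *)
Lemma sintegral_vmM phi psi :
  sintegral_vm mu (mul_nnsfun phi psi) =
  sintegral_vm mu phi ** sintegral_vm mu psi.
Proof.
rewrite (@sintegral_vm_pair _ _ _ _ mu phi psi _ (fun r s => r * s))//.
rewrite /sintegral_vm !fsbig_finite//= vmulv_suml; apply: eq_bigr => r _.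
rewrite vmulv_sumr; apply: eq_bigr => s _.
by rewrite mu_spectral ?vmulZl ?vmulZr ?scalerA//; exact: measurable_level.
Qed.

End SpectralSimpleIntegral.

(** * The order integral of nonnegative functions *)

Section OrderIntegral.
Context {dX : measure_display} {X : measurableType dX} {R : realType}.
Context {A : vlAlgType R} (mu : vmeasure X A).
Context (A_sigma_complete : sigma_dedekind_complete [set: A]).
Context (A_mul_continuous : sigma_monotone_continuous_mul A).
Context (mu_spectral : spectral mu).
Implicit Types (phi : nat -> {nnsfun X >-> R}) (psi chi : {nnsfun X >-> R}).
Implicit Types (f g h : X -> R) (a b c : A).

(** Increasing pointwise convergence to a real-valued [f], free of extended reals: the last clause
    is the approximation property of a supremum. *)
Definition simple_approx phi f :=
  [/\ forall x, {homo (fun n => phi n x) : m n / (m <= n)%N >-> m <= n},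
      forall n x, phi n x <= f x
    & forall x r, r < f x -> exists n, r < phi n x].

Lemma simple_approxP phi f :
  (forall x, seq_up [set: \bar R] (fun n => (phi n x)%:E) (f x)%:E) <->
  simple_approx phi f.
Proof.
split=> [up|[inc le adh] x].
  split=> [x m n mn|n x|x r rf].
  - by have [/(_ m n mn)] := up x; rewrite lee_fin.
  - by have [_ [_ ub _]] := up x; rewrite -lee_fin; apply: ub; exists n.
  - have [_ [_ _ lub]] := up x; apply/not_existsP => noph.
    suff : ((f x)%:E <= r%:E)%E by rewrite lee_fin leNgt rf.
    apply: lub => // _ [n _ <-]; rewrite lee_fin leNgt.
    by apply/negP; exact: noph.
split=> [m n mn|]; first by rewrite lee_fin inc.
split=> // [_ [n _ <-]|u _ ub]; first by rewrite lee_fin le.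
rewrite leNgt; apply/negP; case: u ub => [r| |] ub.
- rewrite lte_fin => /adh[n]; rewrite ltNge => /negP; apply.
  by rewrite -lee_fin; apply: ub; exists n.
- by [].
- by move=> _; have /= := ub _ (ex_intro2 _ _ 0%N I erefl); rewrite leeNy_eq.
Qed.

Lemma simple_approx_exists f : measurable_fun [set: X] f ->
  (forall x, 0 <= f x) -> exists phi, simple_approx phi f.
Proof.
move=> mf f0; have mEf : measurable_fun [set: X] (EFin \o f).
  exact/measurable_EFinP.
exists (nnsfun_approx measurableT mEf); apply/simple_approxP => x.
have nd : nondecreasing_seq (fun n => (nnsfun_approx measurableT mEf n x)%:E).
  move=> m n mn; rewrite lee_fin.
  by have /lefP := nd_nnsfun_approx measurableT mEf mn; exact.
have cf := @cvg_nnsfun_approx _ _ _ _ measurableT _ mEf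
  (fun x _ => f0 x : (0 <= (EFin \o f) x)%E) x I.
have -> : (f x)%:E = ereal_sup (range (fun n =>
    (nnsfun_approx measurableT mEf n x)%:E)).
  exact: (cvg_unique (@ereal_hausdorff R)) cf (ereal_nondecreasing_cvgn nd).
split=> //.
by split=> // [y ry|u _ ub]; [exact: ereal_sup_ubound|exact: ge_ereal_sup].
Qed.

Definition simple_integrals_below f : set A :=
  [set sintegral_vm mu psi | psi in
    [set psi : {nnsfun X >-> R} | forall x, psi x <= f x]].

(* Unlike [is_ointegral], this involves no choice of an approximating
   sequence. *)
Definition has_integral f a := sup_in [set: A] (simple_integrals_below f) a.

Lemma has_integral_ub f a psi : has_integral f a ->
  (forall x, psi x <= f x) -> sintegral_vm mu psi <= a.
Proof. by move=> [_ ub _] psif; apply: ub; exists psi. Qed.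

Lemma has_integral_lub f a b : has_integral f a ->
  (forall psi, (forall x, psi x <= f x) -> sintegral_vm mu psi <= b) -> a <= b.
Proof.
by move=> [_ _ lub] psib; apply: lub => // _ [psi psif <-]; exact: psib.
Qed.

Lemma has_integral_unique f a b :
  has_integral f a -> has_integral f b -> a = b.
Proof. exact: sup_unique. Qed.

Lemma has_integral_le f g a b : (forall x, f x <= g x) ->
  has_integral f a -> has_integral g b -> a <= b.
Proof.
move=> fg fa gb; apply: (has_integral_lub fa) => psi psif.
by apply: (has_integral_ub gb) => x; exact: le_trans (psif x) (fg x).
Qed.

Lemma has_integral_simple psi : has_integral psi (sintegral_vm mu psi).
Proof.
split=> // [_ [chi chipsi <-]|b _ ub]; first exact: sintegral_vm_le.
by apply: ub; exists psi => /=.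
Qed.

(* Spectrality turns the integral over a subset into a multiplication by its
   measure, and the monotone continuity of the multiplication lets the sets on
   which [psi] is almost dominated by [g n] exhaust the whole space. *)
Lemma sintegral_le_sup (g : nat -> X -> R) psi b :
  (forall n, measurable_fun [set: X] (g n)) ->
  (forall x, {homo (fun n => g n x) : m n / (m <= n)%N >-> m <= n}) ->
  (forall n x, 0 <= g n x) ->
  (forall x r, r < psi x -> exists n, r < g n x) ->
  (forall n chi, (forall x, chi x <= g n x) -> sintegral_vm mu chi <= b) ->
  sintegral_vm mu psi <= b.
Proof.
move=> mg g_inc g0 g_adh gb; set s := sintegral_vm mu psi.
have b0 : 0 <= b.
  apply: le_trans (sintegral_vm_ge0 mu nnsfun0) _; apply: (gb 0%N) => x.
  exact: g0.
rewrite -subv_ge0 -[_ - _]opprB -oppr0 lev_opp2.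
(* For [n = k + 1], the bound of [(s - b) *+ n] by [b] says that [(k + 1) s] is at most [(k + 2) b].
   This dictates the factors in [E] and [r]. *)
apply: (@archimedean_le0 _ _ _ b) => -[|k]; first by rewrite mulr0n.
have k1 : 0 < k.+1%:R :> R by [].
have k2 : 0 < k.+2%:R :> R by [].
pose E n := [set x | k.+1%:R * psi x <= k.+2%:R * g n x].
have mE n : measurable (E n).
  rewrite -[E n]setTI; apply: measurable_fun_le => //.
    exact: measurable_funM.
  exact: measurable_funM.
have ndE : nondecreasing_seq E.
  move=> m n mn; apply/subsetPset => x /= /le_trans; apply.
  by rewrite ler_pM2l// g_inc.
have bigE : \bigcup_n E n = [set: X].
  rewrite -subTset => x _.
  (* Where [psi] vanishes, shrinking it leaves no strict inequality for [g_adh]; there [0 <= g n x]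
     suffices. *)
  have [psi0|psi_gt0] := leP (psi x) 0.
    exists 0%N => //=; apply: (@le_trans _ _ 0).
      by rewrite mulr_ge0_le0.
    by rewrite mulr_ge0.
  have [|n] := g_adh x (k.+1%:R / k.+2%:R * psi x).
    by rewrite mulrAC ltr_pdivrMr// mulrC ltr_pM2l// ltr_nat.
  move=> ltg; exists n => //=; apply: ltW.
  by move: ltg; rewrite mulrAC ltr_pdivrMr// [g n x * _]mulrC.
pose r : R := k.+2%:R / k.+1%:R.
(* The left side is the integral of [psi] times the indicator of [E n]; scaled by the inverse of
   [r], that function lies below [g n]. *)
have sE n : s ** mu (E n) <= r *: b.
  have c0 : 0 <= k.+1%:R / k.+2%:R :> R by rewrite divr_ge0.
  have := gb n (scale_nnsfun (mul_nnsfun psi (indic_nnsfun R (mE n))) c0).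
  rewrite sintegral_vmZ sintegral_vmM// sintegral_vm_indic => H.
  rewrite -[leLHS]scale1r -[1](@mulfV _ r) ?mulf_neq0 ?invr_eq0//.
  rewrite -scalerA; apply: lev_scale; first by rewrite divr_ge0.
  rewrite /r invf_div; apply: H => x /=.
  rewrite mindicE; case: (boolP (x \in E n)); rewrite ?inE ?mulr1 => xE.
    by rewrite mulrAC ler_pdivrMr// [g n x * _]mulrC.
  by rewrite !mulr0 g0.
have sr : s <= r *: b.
  have -> : s = s ** mu [set: X].
    rewrite -(sintegral_vm_indic mu measurableT) -sintegral_vmM//.
    by apply: sintegral_vm_eq => x /=; rewrite mindicE in_setT mulr1.
  have muE := vmeasure_continuous_below mu mE ndE; rewrite bigE in muE.
  have inc : increasing_net (fun m n => (m <= n)%N) (mu \o E).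
    by move=> m n mn; apply: vmeasure_le => //; exact/subsetPset/ndE.
  have [[_ +] _] := @A_mul_continuous (mu \o E) (mu [set: X])
    (fun n => vmeasure_ge0 mu (mE n)) (vmeasure_ge0 mu measurableT)
    (conj inc muE) s (sintegral_vm_ge0 mu psi).
  by move=> sup; exact: sup_range_le sup sE.
have := lev_scale (ltW k1) sr; rewrite scalerA mulrCA mulfV// mulr1.
by rewrite !scaler_nat mulrnBl lev_subl_addr [b *+ k.+2]mulrS.
Qed.

(** This is the independence of the approximating sequence. Speaking of upper bounds instead of
    suprema, it also covers the value [None] of the integral. *)
Lemma approx_ub phi f b : simple_approx phi f ->
  ubound (range (fun n => sintegral_vm mu (phi n))) b <->
  ubound (simple_integrals_below f) b.
Proof.
move=> [inc le adh]; split=> [/ubound_range phib _ [psi /= psif <-]|psib].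
  apply: (@sintegral_le_sup (fun n => phi n)) => // [x r rpsi|n chi chiphi].
    by apply: adh; exact: lt_le_trans rpsi (psif x).
  exact: le_trans (sintegral_vm_le mu chiphi) (phib n).
by apply/ubound_range => n; apply: psib; exists (phi n) => //= x; exact: le.
Qed.

Lemma has_integral_approx phi f a : simple_approx phi f ->
  sup_in [set: A] (range (fun n => sintegral_vm mu (phi n))) a <->
  has_integral f a.
Proof.
move=> app; split; apply: sup_same_ub => b; last apply: iff_sym;
  exact: approx_ub app.
Qed.

(** The simple functions below [f] may form an uncountable family, so sigma-completeness is applied
    to one approximating sequence, which has the same upper bounds. *)
Lemma has_integral_exists f b : measurable_fun [set: X] f ->
  (forall x, 0 <= f x) ->
  (forall psi, (forall x, psi x <= f x) -> sintegral_vm mu psi <= b) ->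
  exists a, has_integral f a.
Proof.
move=> mf f0 fb; have [phi app] := simple_approx_exists mf f0.
have [_ le _] := app.
have [||||a sa] := A_sigma_complete
  (S := range (fun n => sintegral_vm mu (phi n))) => //.
- by exists (sintegral_vm mu (phi 0%N)), 0%N.
- exact: card_image_le.
- by exists b => //; apply/ubound_range => n; apply: fb => x; exact: le.
by exists a; exact/(has_integral_approx _ app).
Qed.

Lemma is_ointegralP f a : measurable_fun [set: X] f -> (forall x, 0 <= f x) ->
  is_ointegral mu (fun x => (f x)%:E) (Some a) <-> has_integral f a.
Proof.
move=> mf f0; split=> [[phi [/simple_approxP app sup]]|fa].
  exact/(has_integral_approx _ app).
have [phi app] := simple_approx_exists mf f0.
exists phi; split; first exact/simple_approxP.
exact/(has_integral_approx _ app).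
Qed.

(** What [xget] selects is forced: two finite values are suprema of the same set, and [None] is
    impossible because [a] bounds the integrals of every approximating sequence. *)
Lemma ointegralP f a : measurable_fun [set: X] f -> (forall x, 0 <= f x) ->
  ointegral mu (fun x => (f x)%:E) = Some a <-> has_integral f a.
Proof.
move=> mf f0; rewrite /ointegral; split=> [|fa].
  by case: xgetP => [v _ iv va|//]; apply/is_ointegralP; rewrite -?va.
apply: xget_unique; first exact/is_ointegralP.
case=> [b /is_ointegralP fb|[phi [/simple_approxP app]] []].
  by congr Some; apply: has_integral_unique fa; exact: fb.
by have [_ ub _] := fa; exists a; exact/(approx_ub _ app).
Qed.

Lemma has_integral_dominated f g b : measurable_fun [set: X] f ->
  (forall x, 0 <= f x <= g x) -> has_integral g b ->
  exists a, has_integral f a.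
Proof.
move=> mf fg gb; apply: (@has_integral_exists _ b) => // [x|psi psif].
  by have /andP[] := fg x.
apply: (has_integral_ub gb) => x; apply: le_trans (psif x) _.
by have /andP[] := fg x.
Qed.

Lemma has_integral_ge0 f a :
  (forall x, 0 <= f x) -> has_integral f a -> 0 <= a.
Proof.
move=> f0 fa; apply: le_trans (sintegral_vm_ge0 mu nnsfun0) _.
exact: has_integral_ub fa _.
Qed.

Lemma has_integralD f g a b :
  measurable_fun [set: X] f -> (forall x, 0 <= f x) ->
  measurable_fun [set: X] g -> (forall x, 0 <= g x) ->
  has_integral f a -> has_integral g b ->
  has_integral (fun x => f x + g x) (a + b).
Proof.
move=> mf f0 mg g0.
have [phi appf] := simple_approx_exists mf f0.
have [psi appg] := simple_approx_exists mg g0.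
move=> /(has_integral_approx _ appf) fa /(has_integral_approx _ appg) gb.
have [incf lef adhf] := appf; have [incg leg adhg] := appg.
have app : simple_approx (fun n => add_nnsfun (phi n) (psi n))
    (fun x => f x + g x).
  split=> [x m n mn|n x|x r rfg] /=.
  - by apply: lerD; [exact: incf|exact: incg].
  - by apply: lerD; [exact: lef|exact: leg].
  (* Approximating [f x] first, and then [g x] within the margin that is left, avoids splitting an
     epsilon. *)
  - have [m rm] : exists m, r - g x < phi m x.
      by apply: adhf; rewrite ltrBlDr.
    have [n rn] : exists n, r - phi m x < psi n x.
      by apply: adhg; rewrite ltrBlDr addrC -ltrBlDr.
    exists (maxn m n); move: rn; rewrite ltrBlDr => /lt_le_trans; apply.
    rewrite addrC; apply: lerD; first by apply: incf; exact: leq_maxl.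
    by apply: incg; exact: leq_maxr.
apply/(has_integral_approx _ app); apply: sup_rangeI => [n|c cb].
  by rewrite sintegral_vmD; apply: lev_add;
    [exact: sup_range_ub fa|exact: sup_range_ub gb].
apply: (sup_add_le fa gb) => m n.
apply: le_trans (cb (maxn m n)); rewrite sintegral_vmD.
by apply: lev_add; apply: sintegral_vm_le => x;
  [apply: incf; exact: leq_maxl|apply: incg; exact: leq_maxr].
Qed.

Lemma has_integralZ f a (k : R) : 0 <= k ->
  measurable_fun [set: X] f -> (forall x, 0 <= f x) ->
  has_integral f a -> has_integral (fun x => k * f x) (k *: a).
Proof.
move=> k0 mf f0.
have [phi app] := simple_approx_exists mf f0.
move=> /(has_integral_approx _ app) fa; have [inc le adh] := app.
have app' : simple_approx (fun n => scale_nnsfun (phi n) k0)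
    (fun x => k * f x).
  split=> [x m n mn|n x|x r] /=.
  - by apply: ler_wpM2l => //; exact: inc.
  - by apply: ler_wpM2l => //; exact: le.
  - move: k0; rewrite le_eqVlt => /predU1P[<- |k0].
      by rewrite !mul0r => r0; exists 0%N; rewrite mul0r.
    rewrite -ltr_pdivrMl// => /adh[n rn].
    by exists n; rewrite -ltr_pdivrMl.
apply/(has_integral_approx _ app'); apply: sup_rangeI => [n|c cb].
  by rewrite sintegral_vmZ; apply: lev_scale => //; exact: sup_range_ub fa.
have := k0; rewrite le_eqVlt => /predU1P[k00|kgt0].
  by have := cb 0%N; rewrite sintegral_vmZ -k00 !scale0r.
have kV0 : 0 <= k^-1 by rewrite invr_ge0.
suff : a <= k^-1 *: c.
  by move=> /(lev_scale k0); rewrite scalerA mulfV ?scale1r// gt_eqF.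
apply: (sup_range_le fa) => n; have := lev_scale kV0 (cb n).
by rewrite sintegral_vmZ scalerA mulVf ?scale1r// gt_eqF.
Qed.

Lemma has_integralM f g a b :
  measurable_fun [set: X] f -> (forall x, 0 <= f x) ->
  measurable_fun [set: X] g -> (forall x, 0 <= g x) ->
  has_integral f a -> has_integral g b ->
  has_integral (fun x => f x * g x) (a ** b).
Proof.
move=> mf f0 mg g0.
have [phi appf] := simple_approx_exists mf f0.
have [psi appg] := simple_approx_exists mg g0.
move=> fa gb.
have a0 := has_integral_ge0 f0 fa; have b0 := has_integral_ge0 g0 gb.
move: fa gb.
move=> /(has_integral_approx _ appf) fa /(has_integral_approx _ appg) gb.
have [incf lef adhf] := appf; have [incg leg adhg] := appg.
have app : simple_approx (fun n => mul_nnsfun (phi n) (psi n))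
    (fun x => f x * g x).
  split=> [x m n mn|n x|x r rfg] /=.
  - by apply: ler_pM; rewrite ?fun_ge0 ?incf ?incg.
  - by apply: ler_pM; rewrite ?fun_ge0.
  - have [r0|r0] := ltP r 0.
      by exists 0%N; apply: lt_le_trans r0 _; rewrite mulr_ge0.
    (* As for sums, but with quotients in place of differences: [0 <= r] makes [g x], and later
       [phi m x], positive divisors. *)
    have gx0 : 0 < g x.
      rewrite lt_neqAle g0 andbT; apply/eqP => gx.
      by move: rfg; rewrite -gx mulr0 ltNge r0.
    have [m rm] : exists m, r / g x < phi m x.
      by apply: adhf; rewrite ltr_pdivrMr.
    have phi0 : 0 < phi m x by apply: le_lt_trans rm; rewrite divr_ge0.
    have [n rn] : exists n, r / phi m x < psi n x.
      by apply: adhg; rewrite ltr_pdivrMr// mulrC -ltr_pdivrMr.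
    exists (maxn m n); move: rn; rewrite ltr_pdivrMr// => /lt_le_trans; apply.
    rewrite mulrC; apply: ler_pM => //; first by apply: incf; exact: leq_maxl.
    by apply: incg; exact: leq_maxr.
apply/(has_integral_approx _ app); apply: sup_rangeI => [n|c cb].
  rewrite sintegral_vmM//; apply: lev_mul => //.
  - exact: sintegral_vm_ge0.
  - exact: sup_range_ub fa.
  - exact: sup_range_ub gb.
apply: (vmul_sup_le A_mul_continuous _ _ _ _ fa gb).
- by move=> m n mn; apply: sintegral_vm_le => x; exact: incf.
- by move=> m n mn; apply: sintegral_vm_le => x; exact: incg.
- by move=> n; exact: sintegral_vm_ge0.
- by move=> n; exact: sintegral_vm_ge0.
move=> m n.
apply: le_trans (cb (maxn m n)); rewrite sintegral_vmM//.
apply: lev_mul; try exact: sintegral_vm_ge0.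
  by apply: sintegral_vm_le => x; apply: incf; exact: leq_maxl.
by apply: sintegral_vm_le => x; apply: incg; exact: leq_maxr.
Qed.

(** Monotone convergence: every simple function below [h] is handled by [sintegral_le_sup], which
    already allows measurable [g n]. *)
Lemma has_integral_monotone (g : nat -> X -> R) (u : nat -> A) h a :
  (forall n, measurable_fun [set: X] (g n)) ->
  (forall x, {homo (fun n => g n x) : m n / (m <= n)%N >-> m <= n}) ->
  (forall n x, 0 <= g n x) -> (forall n x, g n x <= h x) ->
  (forall x r, r < h x -> exists n, r < g n x) ->
  (forall n, has_integral (g n) (u n)) -> has_integral h a ->
  sup_in [set: A] (range u) a.
Proof.
move=> mg g_inc g0 gh g_adh gu ha; apply: sup_rangeI => [n|b ub].
  exact: has_integral_le (gh n) (gu n) ha.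
apply: (has_integral_lub ha) => psi psih.
apply: (sintegral_le_sup mg g_inc g0) => [x r rpsi|n chi chig].
  by apply: g_adh; exact: lt_le_trans rpsi (psih x).
exact: le_trans (has_integral_ub (gu n) chig) (ub n).
Qed.

(** A simple function below [f] equals its product with the indicator of [D], so its integral is a
    multiple of [mu D]. *)
Lemma has_integral_null f (D : set X) : measurable D -> mu D = 0 ->
  measurable_fun [set: X] f -> (forall x, 0 <= f x) ->
  (forall x, ~ D x -> f x = 0) -> has_integral f 0.
Proof.
move=> mD D0 mf f0 fD; split=> // [_ [psi /= psif <-]|b _ ub].
  rewrite (_ : sintegral_vm mu psi = sintegral_vm mu psi ** mu D).
    by rewrite D0 vmul0r.
  rewrite -(sintegral_vm_indic mu mD) -sintegral_vmM//.
  apply: sintegral_vm_eq => x /=; rewrite mindicE.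
  case: (boolP (x \in D)); rewrite ?mulr1// mulr0 => /negP xD.
  apply/eqP; rewrite eq_le fun_ge0 andbT -(fD x)//.
  by move=> Dx; apply: xD; rewrite inE.
apply: le_trans (sintegral_vm_ge0 mu nnsfun0) _; apply: ub.
by exists nnsfun0.
Qed.

(** Chebyshev's inequality: a positive multiple of the indicator of [D n] lies below [f], and the
    sets [D n] exhaust the points where [f] is positive. *)
Lemma has_integral0_ae f : measurable_fun [set: X] f ->
  (forall x, 0 <= f x) -> has_integral f 0 -> vmeasure_ae mu (fun x => f x = 0).
Proof.
move=> mf f0 fI0.
pose D n := [set x | n.+1%:R^-1 <= f x].
have mD n : measurable (D n).
  by rewrite -[D n]setTI; apply: measurable_fun_le.
have D0 n : mu (D n) = 0.
  apply/eqP; rewrite eq_le vmeasure_ge0// andbT.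
  have n0 : 0 <= n.+1%:R^-1 :> R by rewrite invr_ge0.
  have := has_integral_ub (psi := scale_nnsfun (indic_nnsfun R (mD n)) n0) fI0.
  rewrite sintegral_vmZ sintegral_vm_indic => H.
  have {}H : n.+1%:R^-1 *: mu (D n) <= 0.
    apply: H => x /=; rewrite mindicE.
    by case: (boolP (x \in D n)); rewrite ?inE ?mulr1 ?mulr0.
  have := lev_scale (ler0n R n.+1) H.
  by rewrite scalerA mulfV// scale1r scaler0.
exists (\bigcup_n D n); split.
- exact: bigcup_measurable.
- exact: vmeasure_bigcup_null.
- move=> x xD; apply/eqP; rewrite eq_le f0 andbT leNgt; apply/negP => fx0.
  apply: xD; exists (Num.truncn (f x)^-1) => //=.
  rewrite /D /= -[leRHS]invrK lef_pV2 ?posrE ?invr_gt0//.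
  exact/ltW/truncnS_gt.
Qed.

End OrderIntegral.

(** * Integrable functions *)

Section IntegrableFunctions.
Context {dX : measure_display} {X : measurableType dX} {R : realType}.
Context {A : vlAlgType R} (mu : vmeasure X A).
Context (A_sigma_complete : sigma_dedekind_complete [set: A]).
Context (A_mul_continuous : sigma_monotone_continuous_mul A).
Context (mu_spectral : spectral mu).
Implicit Types (f g h : {mfun X >-> R}) (a b c : A).

Local Notation hasI := (has_integral mu).

Definition posf (u : X -> R) x := Num.max (u x) 0.

Lemma posf_ge0 u x : 0 <= posf u x.
Proof. by rewrite /posf le_max lexx orbT. Qed.

Lemma measurable_posf (u : X -> R) :
  measurable_fun [set: X] u -> measurable_fun [set: X] (posf u).
Proof. by move=> mu_; exact: measurable_maxr. Qed.

Lemma posf_sub (u : X -> R) x : posf u x - posf (\- u) x = u x.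
Proof.
rewrite /posf /=; case: (leP (u x) 0) => u0.
  by rewrite max_l ?oppr_ge0// sub0r opprK.
by rewrite max_r ?subr0// oppr_le0 ltW.
Qed.

Lemma posf_add (u : X -> R) x : posf u x + posf (\- u) x = `|u x|.
Proof.
rewrite /posf /=; case: (leP (u x) 0) => u0.
  by rewrite max_l ?oppr_ge0// add0r ler0_norm.
by rewrite max_r ?addr0 ?gtr0_norm// oppr_le0 ltW.
Qed.

Lemma calL1P f : calL1 mu f <-> exists a, hasI (fun x => `|f x|) a.
Proof.
have mf : measurable_fun [set: X] (fun x => `|f x|).
  exact: measurableT_comp.
by split=> -[a fa]; exists a; exact/(ointegralP A_mul_continuous mu_spectral).
Qed.

Lemma calL1_dominated f g : calL1 mu g -> (forall x, `|f x| <= `|g x|) ->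
  calL1 mu f.
Proof.
move=> /calL1P[b gb] fg; apply/calL1P.
apply: (has_integral_dominated A_sigma_complete A_mul_continuous mu_spectral)
  gb => [|x]; last by rewrite normr_ge0 fg.
exact: measurableT_comp.
Qed.

Lemma has_integral_posf f : calL1 mu f -> exists a, hasI (posf f) a.
Proof.
move=> /calL1P[b fb].
apply: (has_integral_dominated A_sigma_complete A_mul_continuous mu_spectral)
  fb => [|x]; first exact: measurable_posf.
by rewrite posf_ge0 -posf_add lerDl posf_ge0.
Qed.

Lemma Imu_posf f a b : hasI (posf f) a -> hasI (posf (\- f)) b ->
  Imu mu f = a - b.
Proof.
have mNf : measurable_fun [set: X] (\- f) by exact: measurableT_comp.
move=> /(ointegralP A_mul_continuous mu_spectral _
  (measurable_posf (measurable_funPT f)) (posf_ge0 f)) fa.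
move=> /(ointegralP A_mul_continuous mu_spectral _
  (measurable_posf mNf) (posf_ge0 _)) fb.
by rewrite /Imu; rewrite /posf /= in fa fb; rewrite fa fb.
Qed.

(** Frees [Imu] from the canonical parts of [f]. Writing [u - v] as the difference of these parts
    and moving the negative terms across gives an equality of sums of nonnegative functions, to
    which additivity applies. Linearity and multiplicativity then only require some convenient
    decomposition. *)
Lemma calL1_Imu_diff f (u v : X -> R) a b :
  measurable_fun [set: X] u -> (forall x, 0 <= u x) ->
  measurable_fun [set: X] v -> (forall x, 0 <= v x) ->
  hasI u a -> hasI v b -> (forall x, f x = u x - v x) ->
  calL1 mu f /\ Imu mu f = a - b.
Proof.
move=> mU u0 mv v0 ua vb fE.
have uv := has_integralD A_mul_continuous mu_spectral mU u0 mv v0 ua vb.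
have fL1 : calL1 mu f.
  apply/calL1P.
  apply: (has_integral_dominated A_sigma_complete A_mul_continuous mu_spectral)
    uv => [|x]; first exact: measurableT_comp.
  by rewrite normr_ge0 fE ler_norml; have := u0 x; have := v0 x; lra.
split=> //.
have [a' fa'] := has_integral_posf fL1.
have NfL1 : calL1 mu (- f).
  by apply: calL1_dominated fL1 _ => x; rewrite [(- f) x]/(- f x) normrN.
have [b' fb'] : exists b', hasI (posf (\- f)) b' := has_integral_posf NfL1.
rewrite (Imu_posf fa' fb').
have mf := measurable_posf (measurable_funPT f).
have mNf : measurable_fun [set: X] (posf (\- f)).
  exact: measurable_posf (measurable_funPT (- f)).
have := has_integralD A_mul_continuous mu_spectral mf (posf_ge0 _) mv v0
  fa' vb.
have := has_integralD A_mul_continuous mu_spectral mU u0 mNf (posf_ge0 _)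
  ua fb'.
have -> : (fun x => u x + posf (\- f) x) = (fun x => posf f x + v x).
  by apply/funext => x; have := posf_sub f x; rewrite fE; lra.
move=> h1 h2; apply/eqP; rewrite subr_eq addrAC.
by rewrite (has_integral_unique h1 h2) addrK.
Qed.

Lemma calL1_Imu_ge0 f a : (forall x, 0 <= f x) -> hasI f a ->
  calL1 mu f /\ Imu mu f = a.
Proof.
move=> f0 fa; rewrite -[a]subr0.
apply: (@calL1_Imu_diff f f (fun=> 0) a 0) => // [|x]; last by rewrite subr0.
exact: (has_integral_null mu_spectral measurable0 (vmeasure0 mu)).
Qed.

Lemma has_integral_Imu f : calL1 mu f -> (forall x, 0 <= f x) ->
  hasI f (Imu mu f).
Proof.
move=> /calL1P[a fa] f0; suff fa' : hasI f a.
  by have [_ ->] := calL1_Imu_ge0 f0 fa'.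
rewrite (_ : f = (fun x => `|f x|) :> (X -> R))//.
by apply/funext => x; rewrite ger0_norm.
Qed.

Lemma calL1_parts f : calL1 mu f -> exists a b,
  [/\ hasI (posf f) a, hasI (posf (\- f)) b & Imu mu f = a - b].
Proof.
move=> fL1; have [a fa] := has_integral_posf fL1.
have NfL1 : calL1 mu (- f).
  by apply: calL1_dominated fL1 _ => x; rewrite [(- f) x]/(- f x) normrN.
have [b fb] : exists b, hasI (posf (\- f)) b := has_integral_posf NfL1.
by exists a, b; split => //; exact: Imu_posf.
Qed.

Let measurable_posfN f : measurable_fun [set: X] (posf (\- f)).
Proof. exact: measurable_posf (measurable_funPT (- f)). Qed.

Lemma calL1_ImuN f : calL1 mu f -> calL1 mu (- f) /\ Imu mu (- f) = - Imu mu f.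
Proof.
move=> /calL1_parts[a [b [fa fb ->]]]; rewrite opprB.
apply: (calL1_Imu_diff _ (posf_ge0 _) _ (posf_ge0 _) fb fa) => //.
- exact: measurable_posf.
- by move=> x; rewrite -[LHS]/(- f x) -{1}(posf_sub f x) opprB.
Qed.

Lemma calL1_ImuD f g : calL1 mu f -> calL1 mu g ->
  calL1 mu (f + g) /\ Imu mu (f + g) = Imu mu f + Imu mu g.
Proof.
move=> /calL1_parts[a [b [fa fb ->]]] /calL1_parts[c [d [gc gd ->]]].
rewrite addrACA -opprD.
have mf := measurable_posf (measurable_funPT f).
have mg := measurable_posf (measurable_funPT g).
have D := has_integralD A_mul_continuous mu_spectral.
have fg := D _ _ _ _ mf (posf_ge0 _) mg (posf_ge0 _) fa gc.
have Nfg := D _ _ _ _ (measurable_posfN f) (posf_ge0 _) (measurable_posfN g)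
  (posf_ge0 _) fb gd.
apply: (calL1_Imu_diff _ _ _ _ fg Nfg) => [|x||x|x].
- exact: measurable_funD.
- by rewrite addr_ge0 ?posf_ge0.
- exact: measurable_funD.
- by rewrite addr_ge0 ?posf_ge0.
- by rewrite -[LHS]/(f x + g x) -{1}(posf_sub f x) -{1}(posf_sub g x); lra.
Qed.

Lemma calL1_ImuZ_ge0 f (k : R) : 0 <= k -> calL1 mu f ->
  calL1 mu (k *: f) /\ Imu mu (k *: f) = k *: Imu mu f.
Proof.
move=> k0 /calL1_parts[a [b [fa fb ->]]]; rewrite scalerBr.
have mf := measurable_posf (measurable_funPT f).
have Z := has_integralZ A_mul_continuous mu_spectral k0.
have kf := Z _ _ mf (posf_ge0 _) fa.
have kNf := Z _ _ (measurable_posfN f) (posf_ge0 _) fb.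
apply: (calL1_Imu_diff _ _ _ _ kf kNf) => [|x||x|x].
- exact: measurable_funM.
- by rewrite mulr_ge0 ?posf_ge0.
- by apply: measurable_funM => //; exact: measurable_posfN.
- by rewrite mulr_ge0 ?posf_ge0.
- by rewrite -[LHS]/(k * f x) -{1}(posf_sub f x) mulrBr.
Qed.

Lemma calL1_ImuZ f (k : R) : calL1 mu f ->
  calL1 mu (k *: f) /\ Imu mu (k *: f) = k *: Imu mu f.
Proof.
move=> fL1; have [k0|k0] := leP 0 k; first exact: calL1_ImuZ_ge0.
have Nk0 : 0 <= - k by rewrite oppr_ge0 ltW.
have [fL1' If'] := calL1_ImuZ_ge0 Nk0 fL1.
have [] := calL1_ImuN fL1'.
by rewrite If' !scaleNr !opprK.
Qed.

(** The four products of positive and negative parts, grouped by sign, form a decomposition for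
    [calL1_Imu_diff]. *)
Lemma calL1_ImuM f g : calL1 mu f -> calL1 mu g ->
  calL1 mu (f * g) /\ Imu mu (f * g) = Imu mu f ** Imu mu g.
Proof.
move=> /calL1_parts[a [b [fa fb ->]]] /calL1_parts[c [d [gc gd ->]]].
have mf := measurable_posf (measurable_funPT f).
have mg := measurable_posf (measurable_funPT g).
have D := has_integralD A_mul_continuous mu_spectral.
have M u v s t : measurable_fun [set: X] (posf u) ->
    measurable_fun [set: X] (posf v) -> hasI (posf u) s -> hasI (posf v) t ->
    hasI (fun x => posf u x * posf v x) (s ** t).
  move=> mU mv; exact: (has_integralM A_mul_continuous mu_spectral
    mU (posf_ge0 _) mv (posf_ge0 _)).
have ac := M _ _ _ _ mf mg fa gc.
have bd := M _ _ _ _ (measurable_posfN f) (measurable_posfN g) fb gd.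
have ad := M _ _ _ _ mf (measurable_posfN g) fa gd.
have bc := M _ _ _ _ (measurable_posfN f) mg fb gc.
have M0 u v x : 0 <= posf u x * posf v x by rewrite mulr_ge0 ?posf_ge0.
have mM u v : measurable_fun [set: X] (posf u) ->
    measurable_fun [set: X] (posf v) ->
    measurable_fun [set: X] (fun x => posf u x * posf v x).
  exact: measurable_funM.
have I1 := D _ _ _ _ (mM _ _ mf mg) (M0 _ _)
  (mM _ _ (measurable_posfN f) (measurable_posfN g)) (M0 _ _) ac bd.
have I2 := D _ _ _ _ (mM _ _ mf (measurable_posfN g)) (M0 _ _)
  (mM _ _ (measurable_posfN f) mg) (M0 _ _) ad bc.
have -> : (a - b) ** (c - d) = a ** c + b ** d - (a ** d + b ** c).
  rewrite vmulBl !vmulBr !opprB !opprD !addrA.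
  rewrite -!addrA; congr (_ + _).
  by rewrite addrCA; congr (_ + _); rewrite addrC.
apply: (calL1_Imu_diff _ _ _ _ I1 I2) => [|x||x|x].
- by apply: measurable_funD; apply: mM.
- by rewrite addr_ge0.
- by apply: measurable_funD; apply: mM.
- by rewrite addr_ge0.
- rewrite -[LHS]/(f x * g x) -{1}(posf_sub f x) -{1}(posf_sub g x).
  by rewrite mulrBl !mulrBr; lra.
Qed.

Lemma has_integral_indic (D : set X) (mD : measurable D) :
  hasI (indic_nnsfun R mD : X -> R) (mu D).
Proof. by rewrite -(sintegral_vm_indic mu mD); exact: has_integral_simple. Qed.

Lemma calL1_Imu1 : calL1 mu 1 /\ Imu mu 1 = mu [set: X].
Proof.
apply: calL1_Imu_ge0 => [x|]; first exact: ler01.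
have := has_integral_indic measurableT; congr (has_integral _ _ _).
by apply/funext => x /=; rewrite mindicE in_setT.
Qed.

Lemma calL1_bounded f : bounded_mfun f -> calL1 mu f.
Proof.
move=> [M fM]; have [L1_1 _] := calL1_Imu1.
have [ML1 _] := calL1_ImuZ M L1_1.
apply: calL1_dominated ML1 _ => x.
apply: le_trans (fM x) _; rewrite -[X in _ <= `|X|]/(M * 1) mulr1.
exact: ler_norm.
Qed.

Lemma calN_calL1 f : calN mu f -> calL1 mu f /\ Imu mu f = 0.
Proof.
move=> [D [mD D0 fD]].
have null (u : X -> R) : measurable_fun [set: X] u ->
    (forall x, ~ D x -> u x = 0) -> hasI (posf u) 0.
  move=> mU uD; apply: (has_integral_null mu_spectral mD D0)
    => [|x|x Dx]; first exact: measurable_posf.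
    exact: posf_ge0.
  by rewrite /posf uD// maxxx.
rewrite -[0]subr0.
apply: (calL1_Imu_diff (u := posf f) (v := posf (\- f)) _ (posf_ge0 _) _
  (posf_ge0 _)) => //.
- exact: measurable_posf.
- exact: null.
- apply: null => [|x Dx]; first exact: measurable_funPT (- f).
  by rewrite /= fD// oppr0.
- by move=> x; rewrite posf_sub.
Qed.

(** Makes integrability and the integral well defined on classes. *)
Lemma calL1_ae_eq f g : vmeasure_ae mu (fun x => f x = g x) ->
  calL1 mu f -> calL1 mu g /\ Imu mu g = Imu mu f.
Proof.
move=> fg fL1; have [hL1 hI] : calL1 mu (g - f) /\ Imu mu (g - f) = 0.
  apply: calN_calL1; apply: vmeasure_ae_imply fg => x fgx.
  by rewrite -[LHS]/(g x - f x) fgx subrr.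
have [gL1 gI] := calL1_ImuD hL1 fL1.
by rewrite subrK in gL1 gI; rewrite gI hI add0r.
Qed.

(** * Lattice homomorphism, kernel and range of the integral *)

Section SubIdentity.
Context (e : A) (e_identity : is_identity [set: A] e).
Context (mu_le_e : mu [set: X] <= e).

Lemma vmeasure_le_e D : measurable D -> mu D <= e.
Proof. by move=> mD; apply: le_trans mu_le_e; exact: vmeasure_le. Qed.

(* The positive and negative parts live on complementary sets, whose measures
   are orthogonal and lie below [e]. *)
Lemma has_integral_parts_disjoint f a b :
  hasI (posf f) a -> hasI (posf (\- f)) b -> vmeet a b = 0.
Proof.
move=> fa fb; pose D := [set x | 0 <= f x].
have mD : measurable D by rewrite -[D]setTI; apply: measurable_fun_le.
have mC : measurable (~` D) by exact: measurableC.
have a0 := has_integral_ge0 (posf_ge0 _) fa.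
have b0 := has_integral_ge0 (posf_ge0 _) fb.
apply: (@disjoint_le_orthogonal _ _ e e_identity (mu D) (mu (~` D)) a b).
- exact: vmeasure_ge0.
- exact: vmeasure_le_e.
- exact: vmeasure_ge0.
- exact: vmeasure_le_e.
- by rewrite -mu_spectral// setICl vmeasure0.
- have ind0 x : 0 <= indic_nnsfun R mD x by [].
  have H := has_integralM A_mul_continuous mu_spectral
    (measurable_posf (measurable_funPT f)) (posf_ge0 _)
    (measurable_funPT (indic_nnsfun R mD)) ind0 fa (has_integral_indic mD).
  apply: has_integral_unique H _; congr (has_integral _ _ _): fa.
  apply/funext => x; rewrite /posf /= mindicE.
  case: (boolP (x \in D)); rewrite ?mulr1// mulr0 => /negP; rewrite inE.
  by move=> /negP; rewrite -ltNge => /ltW/max_r.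
- have ind0 x : 0 <= indic_nnsfun R mC x by [].
  have H := has_integralM A_mul_continuous mu_spectral
    (measurable_posfN f) (posf_ge0 _)
    (measurable_funPT (indic_nnsfun R mC)) ind0 fb (has_integral_indic mC).
  apply: has_integral_unique H _; congr (has_integral _ _ _): fb.
  apply/funext => x; rewrite /posf /= mindicE.
  case: (boolP (x \in ~` D)); rewrite ?mulr1// mulr0 => /negP; rewrite inE.
  by move=> /contrapT fx; apply: max_r; rewrite oppr_le0.
- by apply: vmeet_glb.
- exact: vmeet_lbl.
- exact: vmeet_lbr.
Qed.

Lemma calL1_Imu_vpos f : calL1 mu f ->
  calL1 mu (vpos f) /\ Imu mu (vpos f) = vpos (Imu mu f).
Proof.
move=> /calL1_parts[a [b [fa fb ->]]].
rewrite vpos_disjoint ?(has_integral_parts_disjoint fa fb)//.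
by apply: (@calL1_Imu_ge0 (vpos f)) => // x; exact: posf_ge0.
Qed.

Lemma calL1_Imu_join f g : calL1 mu f -> calL1 mu g ->
  calL1 mu (vjoin f g) /\ Imu mu (vjoin f g) = vjoin (Imu mu f) (Imu mu g).
Proof.
move=> fL1 gL1; have [NgL1 NgI] := calL1_ImuN gL1.
have [BL1 BI] := calL1_ImuD fL1 NgL1.
have [pL1 pI] := calL1_Imu_vpos BL1.
have [jL1 jI] := calL1_ImuD gL1 pL1.
by rewrite !vjoin_vpos jI pI BI NgI.
Qed.

Lemma calL1_Imu_meet f g : calL1 mu f -> calL1 mu g ->
  calL1 mu (vmeet f g) /\ Imu mu (vmeet f g) = vmeet (Imu mu f) (Imu mu g).
Proof.
move=> fL1 gL1; have [jL1 jI] := calL1_Imu_join fL1 gL1.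
have [NjL1 NjI] := calL1_ImuN jL1.
have [sL1 sI] := calL1_ImuD fL1 gL1.
have [mL1 mI] := calL1_ImuD sL1 NjL1.
by rewrite !vjoin_meetE mI sI NjI jI.
Qed.

(** Since [Imu] preserves positive parts, the positive parts of [f] and of [- f] both have integral
    zero, and [has_integral0_ae] applies to each. *)
Lemma calL1_Imu_eq0 f : calL1 mu f -> Imu mu f = 0 -> calN mu f.
Proof.
have pos0 h : calL1 mu h -> Imu mu h = 0 ->
    vmeasure_ae mu (fun x => posf h x = 0).
  move=> hL1 hI; have [pL1 pI] := calL1_Imu_vpos hL1.
  apply: (has_integral0_ae (f := posf h)) (posf_ge0 h) _.
    exact: measurable_posf.
  have <- : Imu mu (vpos h) = 0.
    by rewrite pI hI; apply/eqP; rewrite eq_le vpos_ge0 andbT vjoinP lexx.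
  by apply: has_integral_Imu pL1 _ => x; exact: posf_ge0.
move=> fL1 fI; have [NL1 NI] := calL1_ImuN fL1.
have NI0 : Imu mu (- f) = 0 by rewrite NI fI oppr0.
apply: vmeasure_ae_imply2 (pos0 _ fL1 fI) (pos0 _ NL1 NI0) => x f0 Nf0.
by rewrite -(posf_sub f x) f0 sub0r; apply/eqP; rewrite oppr_eq0; apply/eqP.
Qed.

(** Multiplicativity applied to [f = 1 * f * 1] puts [mu [set: X]] on both sides of the integral. *)
Lemma Imu_corner f : calL1 mu f -> corner (mu [set: X]) (Imu mu f).
Proof.
move=> fL1; have [L1_1 I1] := calL1_Imu1.
have [L1f If] := calL1_ImuM L1_1 fL1.
have [_] := calL1_ImuM L1f L1_1.
by rewrite If I1 mul1r mulr1 => ->; exists (Imu mu f).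
Qed.

Lemma Imu_bounded_ideal (J : set A) f :
  order_ideal_in (corner (mu [set: X])) J -> J (mu [set: X]) ->
  bounded_mfun f -> J (Imu mu f).
Proof.
move=> [_ [J0 Jlin] Jsolid] Jp fb; have fL1 := calL1_bounded fb.
have [M fM] := fb; have [L1_1 I1] := calL1_Imu1.
pose k := `|M| *: (1 : {mfun X >-> R}).
have [kL1 kI] : calL1 mu k /\ Imu mu k = `|M| *: mu [set: X].
  by have := calL1_ImuZ `|M| L1_1; rewrite I1.
apply: (Jsolid _ (`|M| *: mu [set: X])); first exact: Imu_corner.
  by rewrite -[_ *: _]addr0; exact: Jlin.
rewrite [leRHS]vabs_pos ?scalev_ge0 ?vmeasure_ge0//.
have h g : calL1 mu g -> (forall x, g x <= M) ->
    Imu mu g <= `|M| *: mu [set: X].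
  (* Monotonicity of the integral is obtained from its compatibility with joins, as [g <= k] means
     [vjoin g k = k]. *)
  move=> gL1 gM; have [jL1 jI] := calL1_Imu_join gL1 kL1.
  have jk : vjoin g k = k.
    apply/mfuneqP => x; apply: max_r.
    by rewrite -[leRHS]/(`|M| * 1) mulr1; exact: le_trans (gM x) (ler_norm M).
  by rewrite -kI -[in leRHS]jk jI; exact: vjoin_ubl.
apply: vjoin_lub.
  by apply: h => // x; apply: le_trans (fM x); exact: ler_norm.
have [NfL1 <-] := calL1_ImuN fL1.
apply: h => // x; apply: le_trans (fM x).
by rewrite -[leLHS]/(- f x) -normrN; exact: ler_norm.
Qed.

(** For [g >= 0] the truncations of [g] at height [n] are bounded, so their integrals lie in [J];
    these increase to the integral of [g] by monotone convergence. A general [f] is split into its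
    parts. *)
Lemma Imu_sigma_ideal (J : set A) f :
  sigma_order_ideal_in (corner (mu [set: X])) J -> J (mu [set: X]) ->
  calL1 mu f -> J (Imu mu f).
Proof.
move=> [Jideal Jsup] Jp.
have Jpos g : calL1 mu g -> (forall x, 0 <= g x) -> J (Imu mu g).
  move=> gL1 g0.
  pose u n := vmeet g (n%:R *: (1 : {mfun X >-> R})).
  have uE n x : u n x = Num.min (g x) n%:R.
    by rewrite -[LHS]/(Num.min (g x) (n%:R * 1)) mulr1.
  have u0 n x : 0 <= u n x by rewrite uE le_min g0 ler0n.
  have ug n x : u n x <= g x by rewrite uE ge_min lexx.
  have uL1 n : calL1 mu (u n).
    by apply: calL1_dominated gL1 _ => x; rewrite !ger0_norm.
  have uinc x : {homo (fun n => u n x) : m n / (m <= n)%N >-> m <= n}.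
    move=> m n mn; by rewrite !uE le_min !ge_min lexx ler_nat mn orbT.
  have uI n := has_integral_Imu (uL1 n) (u0 n).
  have gI := has_integral_Imu gL1 g0.
  have usup : sup_in [set: A] (range (fun n => Imu mu (u n))) (Imu mu g).
    apply: (has_integral_monotone A_mul_continuous mu_spectral
      (g := fun n => u n) (h := g)) => // x r rg.
    exists (Num.truncn (g x)).+1.
    by rewrite uE lt_min rg (lt_trans rg)// truncnS_gt.
  apply: (Jsup (fun n => Imu mu (u n))).
    move=> n; apply: Imu_bounded_ideal => //.
    by exists n%:R => x; rewrite ger0_norm// uE ge_min lexx orbT.
  (* The supremum found in [A] lies in the corner, and so is a supremum there too. *)
  have [_ ub lub] := usup; split.
    move=> m n mn; apply: has_integral_le (uI m) (uI n) => x; exact: uinc.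
  split=> //; first exact: Imu_corner.
  by move=> b _; exact: lub.
move=> fL1; have [NfL1 _] := calL1_ImuN fL1.
have [pL1 _] := calL1_Imu_vpos fL1; have [nL1 _] := calL1_Imu_vpos NfL1.
have [NnL1 NnI] := calL1_ImuN nL1; have [_] := calL1_ImuD pL1 NnL1.
rewrite vpos_subE NnI => ->; rewrite addrC -scaleN1r.
have [_ [_ Jlin] _] := Jideal.
by apply: Jlin; apply: Jpos => // x; exact: posf_ge0.
Qed.

End SubIdentity.

End IntegrableFunctions.

(** * Integrable functions modulo null functions *)

Section Quotient.
Context {dX : measure_display} {X : measurableType dX} {R : realType}.
Context {A : vlAlgType R} (mu : vmeasure X A).
Context (A_sigma_complete : sigma_dedekind_complete [set: A]).
Context (A_mul_continuous : sigma_monotone_continuous_mul A).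
Context (mu_spectral : spectral mu).
Context (e : A) (e_identity : is_identity [set: A] e).
Context (mu_le_e : mu [set: X] <= e).
Implicit Types (f g h : {mfun X >-> R}) (a b c : A) (u v w : L0 mu).

Local Notation pi f := (\pi_(L0 mu) f).
Local Notation T := (Imu_L1 mu).

Let ImuD := calL1_ImuD A_sigma_complete A_mul_continuous mu_spectral.
Let ImuN := calL1_ImuN A_sigma_complete A_mul_continuous mu_spectral.
Let ImuZ := calL1_ImuZ A_sigma_complete A_mul_continuous mu_spectral.
Let ImuM := calL1_ImuM A_sigma_complete A_mul_continuous mu_spectral.
Let ImuJ := calL1_Imu_join A_sigma_complete A_mul_continuous mu_spectral
  e_identity mu_le_e.
Let ImuI := calL1_Imu_meet A_sigma_complete A_mul_continuous mu_spectral
  e_identity mu_le_e.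
Let Imu_ae := calL1_ae_eq A_sigma_complete A_mul_continuous mu_spectral.

Lemma calL1_linear : linear_subspace (calL1 mu).
Proof.
split=> [|a f g fL1 gL1].
  have N0 : calN mu 0 by apply: vmeasure_aeW.
  by have [] := calN_calL1 A_sigma_complete A_mul_continuous mu_spectral N0.
have [kL1 _] := ImuZ a fL1.
by have [] := ImuD kL1 gL1.
Qed.

Lemma calL1_subalgebra : vl_subalgebra (calL1 mu).
Proof.
split=> [|f g fL1 gL1]; last first.
  by have [] := ImuM fL1 gL1.
split=> [|f g fL1 gL1]; first exact: calL1_linear.
by split; [have [] := ImuJ fL1 gL1|have [] := ImuI fL1 gL1].
Qed.

Lemma Imu_hom : vl_algebra_hom_on (calL1 mu) (Imu mu).
Proof.
split=> [|f g fL1 gL1]; last first.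
  by have [] := ImuM fL1 gL1.
split=> [a f g fL1 gL1|f g fL1 gL1].
  have [kL1 kI] := ImuZ a fL1.
  have [_ ->] := ImuD kL1 gL1.
  by rewrite kI.
by split; [have [] := ImuJ fL1 gL1|have [] := ImuI fL1 gL1].
Qed.

Lemma L1_pi f : L1 mu (pi f) <-> calL1 mu f.
Proof.
split=> [[g gL1 /L0_eqP gf]|fL1]; last by exists f.
by have [] := Imu_ae gf gL1.
Qed.

Lemma Imu_L1_pi f : calL1 mu f -> T (pi f) = Imu mu f.
Proof.
have /L0_eqP ff : pi f = pi (repr (pi f)) by rewrite reprK.
move=> fL1.
by have [] := Imu_ae ff fL1.
Qed.

Lemma pi_join f g : pi (vjoin f g) = vjoin (pi f) (pi g).
Proof. exact/esym/L0_joinE. Qed.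

Lemma pi_meet f g : pi (vmeet f g) = vmeet (pi f) (pi g).
Proof. exact/esym/L0_meetE. Qed.

Lemma pi_mul f g : pi (f * g) = pi f ** pi g.
Proof. exact/esym/L0_mulE. Qed.

Lemma L1_subalgebra : vl_subalgebra (L1 mu).
Proof.
have [[[L0 Llin] Llat] Lmul] := calL1_subalgebra.
split=> [|u v [f fL1 <-] [g gL1 <-]]; last first.
  by rewrite -pi_mul; apply/L1_pi; exact: Lmul.
split=> [|u v [f fL1 <-] [g gL1 <-]]; last first.
  by have [] := Llat _ _ fL1 gL1; rewrite -pi_join -pi_meet => ? ?; split;
    exact/L1_pi.
split=> [|a u v [f fL1 <-] [g gL1 <-]]; first by exists 0.
by rewrite -pi_L0Z -pi_L0D; apply/L1_pi; exact: Llin.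
Qed.

Lemma Imu_L1_hom : vl_algebra_hom_on (L1 mu) T.
Proof.
have [[[L0 Llin] Llat] Lmul] := calL1_subalgebra.
have [[Ilin Ilat] Imul] := Imu_hom.
split=> [|u v [f fL1 <-] [g gL1 <-]]; last first.
  by rewrite -pi_mul !Imu_L1_pi ?Imul//; exact: Lmul.
split=> [a|] u v [f fL1 <-] [g gL1 <-]; last first.
  have [jI mI] := Ilat _ _ fL1 gL1; have [jL mL] := Llat _ _ fL1 gL1.
  by rewrite -pi_join -pi_meet !Imu_L1_pi// jI mI.
rewrite -pi_L0Z -pi_L0D !Imu_L1_pi//; first exact: Ilin.
exact: Llin.
Qed.

Let L1D u v : L1 mu u -> L1 mu v -> L1 mu (u + v).
Proof.
have [[[_ lin] _] _] := L1_subalgebra => uL vL.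
by rewrite -[u]scale1r; exact: lin.
Qed.

Let L1B u v : L1 mu u -> L1 mu v -> L1 mu (u - v).
Proof.
have [[[_ lin] _] _] := L1_subalgebra => uL vL.
by rewrite addrC -scaleN1r; exact: lin.
Qed.

Let L1_join u v : L1 mu u -> L1 mu v -> L1 mu (vjoin u v).
Proof.
by have [[_ lat] _] := L1_subalgebra => uL vL; have [] := lat _ _ uL vL.
Qed.

Let L1_meet u v : L1 mu u -> L1 mu v -> L1 mu (vmeet u v).
Proof.
by have [[_ lat] _] := L1_subalgebra => uL vL; have [] := lat _ _ uL vL.
Qed.

Lemma Imu_L1B u v : L1 mu u -> L1 mu v -> T (u - v) = T u - T v.
Proof.
have [[lin _] _] := Imu_L1_hom => uL vL.
by rewrite addrC -scaleN1r lin// scaleN1r addrC.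
Qed.

Lemma Imu_L1_le u v : L1 mu u -> L1 mu v -> u <= v -> T u <= T v.
Proof.
have [[_ lat] _] := Imu_L1_hom => uL vL uv.
have vE : vjoin u v = v by apply/eqP; rewrite eq_le vjoin_ubr vjoinP uv lexx.
by rewrite -vE; have [-> _] := lat _ _ uL vL; exact: vjoin_ubl.
Qed.

Lemma Imu_L1_inj u v : L1 mu u -> L1 mu v -> T u = T v -> u = v.
Proof.
move=> uL vL uv; apply/eqP; rewrite -subr_eq0; apply/eqP.
have [f fL1 fuv] := L1B uL vL.
have := Imu_L1B uL vL; rewrite uv subrr -fuv Imu_L1_pi// => f0.
apply/L0_eqP.
exact: (calL1_Imu_eq0 A_sigma_complete A_mul_continuous mu_spectral e_identity
  mu_le_e fL1 f0).
Qed.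

Lemma mfun_of (k : X -> R) : measurable_fun [set: X] k ->
  exists h, h = k :> (X -> R).
Proof. by move=> mk; exists (mfun_Sub (mem_set mk)). Qed.

(* Representatives for which all the relevant inequalities hold everywhere. *)
Lemma L1_sup_repr (u : nat -> L0 mu) (b : L0 mu) :
  (forall n, L1 mu (u n)) -> L1 mu b -> (forall n, u n <= b) ->
  exists (g : nat -> {mfun X >-> R}) h,
    [/\ forall n, pi (g n) = u n,
        forall m n, u m <= u n -> forall x, g m x <= g n x,
        calL1 mu h, forall n x, g n x <= h x
      & forall x r, r < h x -> exists n, r < g n x].
Proof.
move=> uL bL ub.
pose f n := repr (u n); pose k := repr b.
have fL n : calL1 mu (f n) by apply/L1_pi; rewrite reprK.
have kL : calL1 mu k by apply/L1_pi; rewrite reprK.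
have fk : forall n, vmeasure_ae mu (fun x => f n x <= k x).
  by move=> n; apply/pi_L0_leP; rewrite !reprK.
(* The comparison is conditional so that a single null set serves all pairs of indices, comparable
   or not. *)
have ff : forall m n, vmeasure_ae mu (fun x => u m <= u n -> f m x <= f n x).
  move=> m n; have [umn|umn] := boolP (u m <= u n); last exact: vmeasure_aeW.
  suff /pi_L0_leP : pi (f m) <= pi (f n) by apply: vmeasure_ae_imply.
  by rewrite !reprK.
have [D [mD D0 DP]] := vmeasure_ae_imply2 (fun x => @conj _ _)
  (vmeasure_ae_all fk) (vmeasure_ae_all (fun m => vmeasure_ae_all (ff m))).
(* Multiplying by [i] makes all functions zero on the null set [D], the only place where an
   inequality may fail. *)
pose i := indic_nnsfun R (measurableC mD).
have iE x : D x -> i x = 0.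
  move=> Dx; rewrite /i /= mindicE.
  by case: (boolP (x \in ~` D)) => //; rewrite inE.
have iE' x : ~ D x -> i x = 1 by move=> Dx; rewrite /i /= mindicE mem_set.
pose g n : {mfun X >-> R} := f n * (i : {mfun X >-> R}).
have gE n x : g n x = f n x * i x by [].
have gk n x : g n x <= k x * i x.
  rewrite gE; have [Dx|Dx] := pselect (D x); first by rewrite iE// !mulr0.
  by rewrite iE'// !mulr1; have [] := DP _ Dx.
pose E x : set R := sdrop (fun n => g n x) 0%N.
have Eub x : has_ubound (E x).
  by exists (k x * i x) => _ [n _ <-]; exact: gk.
have Eg n x : E x (g n x) by exists n.
have mh : measurable_fun [set: X] (fun x => sup (E x)).
  apply: (@measurable_fun_sups _ _ _ _ (fun n x => g n x) 0%N) => [x _|n].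
    by exists (k x * i x) => _ [n _ <-]; exact: gk.
  exact: measurable_funPT.
have [h hE] := mfun_of mh.
have gh n x : g n x <= h x by rewrite hE; exact: ub_le_sup.
have hk x : h x <= k x * i x.
  by rewrite hE; apply: ge_sup => [|_ [n _ <-]]; [exists (g 0%N x)|exact: gk].
have ki x : `|k x * i x| <= `|k x|.
  have [Dx|Dx] := pselect (D x); first by rewrite iE// mulr0 normr0.
  by rewrite iE'// mulr1.
have gf n : pi (g n) = u n.
  rewrite -[RHS]reprK; apply/L0_eqP; exists D; split => // x Dx.
  by rewrite gE iE'// mulr1.
have gL n : calL1 mu (g n) by apply/L1_pi; rewrite gf.
exists g, h; split => //.
- move=> m n umn x; rewrite !gE.
  have [Dx|Dx] := pselect (D x); first by rewrite iE// !mulr0.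
  by rewrite iE'// !mulr1; have [_ /(_ m n umn)] := DP _ Dx.
- have [[_ lat] _] := calL1_subalgebra.
  have absL f' : calL1 mu f' -> calL1 mu (vabs f').
    move=> fL'; have [NL _] := ImuN fL'.
    by have [] := lat _ _ fL' NL.
  have absE f' x : (vabs f') x = `|f' x|.
    exact: maxrN.
  (* As [h] lies between [g 0] and the truncated bound [k * i], its modulus is at most the sum of
     those of [g 0] and [k]. *)
  have [sL _] := ImuD (absL _ (gL 0%N)) (absL _ kL).
  apply: (calL1_dominated A_sigma_complete A_mul_continuous mu_spectral sL)
    => x.
  rewrite -[X in _ <= `|X|]/(vabs (g 0%N) x + vabs k x) !absE.
  rewrite [leRHS]ger0_norm ?addr_ge0//.
  have := gh 0%N x; have := hk x; have := ki x.
  rewrite !ler_norml => /andP[k1 k2] h1 h2; apply/andP; split.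
    have := ler_norm (- g 0%N x); rewrite normrN.
    have := normr_ge0 (k x); lra.
  by have := normr_ge0 (g 0%N x); lra.
- move=> x r; rewrite hE => rs.
  have sE : has_sup (E x) by split => //; exists (g 0%N x).
  have eps0 : 0 < sup (E x) - r by rewrite subr_gt0.
  have [_ [n _ <-]] := sup_adherent eps0 sE.
  by rewrite subKr; exists n.
Qed.

(** The inequalities between the [g n] and a representative of an upper bound fail on countably many
    null sets, whose union is null. *)
Let pi_sup (u : nat -> L0 mu) (g : nat -> {mfun X >-> R}) h :
  (forall n, pi (g n) = u n) -> calL1 mu h -> (forall n x, g n x <= h x) ->
  (forall x r, r < h x -> exists n, r < g n x) ->
  sup_in (L1 mu) (range u) (pi h).
Proof.
move=> gu hL gh hg; split; first exact/L1_pi.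
  apply/ubound_range => n; rewrite -gu; apply/pi_L0_leP.
  by apply: vmeasure_aeW => x; exact: gh.
move=> c _ /ubound_range uc; rewrite -(reprK c); apply/pi_L0_leP.
have : forall n, vmeasure_ae mu (fun x => g n x <= repr c x).
  by move=> n; apply/pi_L0_leP; rewrite gu reprK.
move=> /vmeasure_ae_all; apply: vmeasure_ae_imply => x gc.
by rewrite leNgt; apply/negP => /hg[n]; rewrite ltNge gc.
Qed.

Lemma L1_sigma_dedekind_complete : sigma_dedekind_complete (L1 mu).
Proof.
move=> S SL [s0 Ss0] /pfcard_geP[S0|[u]] [b bL Sb].
  by rewrite S0 in Ss0.
have SE : range u = S by exact: image_eq.
have uS n : S (u n) by exact: (@funS _ _ _ _ u).
have [g [h [gu _ hL gh hg]]] := L1_sup_repr (fun n => SL _ (uS n)) bL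
  (fun n => Sb _ (uS n)).
by exists (pi h); rewrite -[X in sup_in _ X]SE; exact: pi_sup gu hL gh hg.
Qed.

(** Monotone convergence is available for nonnegative functions, so it is applied to [g n - g 0],
    for representatives that increase everywhere. *)
Lemma Imu_L1_sup (u : nat -> L0 mu) w : (forall n, L1 mu (u n)) ->
  {homo u : m n / (m <= n)%N >-> m <= n} ->
  sup_in (L1 mu) (range u) w -> sup_in [set: A] (range (T \o u)) (T w).
Proof.
move=> uL u_inc uw; have [wL /ubound_range u_le_w _] := uw.
have [g [h [gu g_inc hL gh hg]]] := L1_sup_repr uL wL u_le_w.
have <- : pi h = w by apply: sup_unique uw; exact: pi_sup gu hL gh hg.
have gL n : calL1 mu (g n) by apply/L1_pi; rewrite gu.
have gI f : calL1 mu f -> (forall x, g 0%N x <= f x) ->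
    has_integral mu (f - g 0%N : {mfun X >-> R}) (Imu mu f - Imu mu (g 0%N)).
  move=> fL gf; have [NL NI] := ImuN (gL 0%N); have [BL BI] := ImuD fL NL.
  rewrite -NI -BI; apply: has_integral_Imu => // x.
  by rewrite -[leRHS]/(f x - g 0%N x) subr_ge0.
have g0 n x : g 0%N x <= g n x by apply: g_inc; exact: u_inc.
have sup0 := has_integral_monotone A_mul_continuous mu_spectral
  (g := fun n => g n - g 0%N : {mfun X >-> R}) (h := h - g 0%N : {mfun X >-> R})
  (fun n => measurable_funPT _).
have {}sup0 : sup_in [set: A] (range (fun n => Imu mu (g n) - Imu mu (g 0%N)))
    (Imu mu h - Imu mu (g 0%N)).
  apply: sup0 => [x m n mn|n x|n x|x r|n|].
  - by rewrite lerD2r; exact/g_inc/u_inc.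
  - by rewrite -[leRHS]/(g n x - g 0%N x) subr_ge0.
  - by rewrite lerD2r; exact: gh.
  - rewrite -[X in r < X]/(h x - g 0%N x) ltrBrDr => /hg[n rn].
    by exists n; rewrite -[X in r < X]/(g n x - g 0%N x) ltrBrDr.
  - exact: gI (gL n) (g0 n).
  - exact: gI hL (gh 0%N).
rewrite Imu_L1_pi//; apply: sup_rangeI => [n|c Tc] /=.
  have := sup_range_ub n sup0; rewrite lev_add2r.
  by rewrite -gu Imu_L1_pi.
have := @sup_range_le _ _ _ _ _ (c - Imu mu (g 0%N)) sup0.
rewrite lev_add2r; apply=> n; rewrite lev_add2r.
by have := Tc n; rewrite /= -gu Imu_L1_pi.
Qed.

(* Reduces decreasing nets to increasing ones: [u i0 - vmeet (u i) (u i0)]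
   increases to [u i0], without restriction to the indices beyond [i0]. *)
Lemma Imu_L1_down (E : set A) (I : Type) (leI : I -> I -> Prop)
    (u : I -> L0 mu) : inhabited I -> E 0 ->
  (forall (v : I -> L0 mu) w, (forall i, L1 mu (v i) /\ 0 <= v i) ->
    net_up (L1 mu) leI v w ->
    sup_in [set: A] (range (T \o v)) (T w)) ->
  (forall i, L1 mu (u i)) -> net_down (L1 mu) leI u 0 ->
  net_down E leI (T \o u) 0.
Proof.
move=> [i0] E0 Tsup uL [u_dec [L0 u0 glb]].
have u_ge0 i : 0 <= u i by apply: u0; exists i.
pose v i := u i0 - vmeet (u i) (u i0).
have mL i : L1 mu (vmeet (u i) (u i0)) by exact: L1_meet.
have vL i : L1 mu (v i) by exact: L1B.
have T0 : T 0 = 0 by rewrite -(subrr (u i0)) Imu_L1B// subrr.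
have vw : sup_in [set: A] (range (T \o v)) (T (u i0)).
  apply: Tsup => [i|].
    by split; [exact: vL|rewrite subv_ge0; exact: vmeet_lbr].
  split=> [i j ij|].
    rewrite lev_add2l lev_opp2; apply: vmeet_glb (vmeet_lbr _ _).
    exact: le_trans (vmeet_lbl _ _) (u_dec _ _ ij).
  split=> //; first by apply/ubound_range => i; apply/lev_subl/vmeet_glb.
  move=> c cL /ubound_range vc; rewrite -subv_ge0 -lev_opp2 oppr0 opprB.
  apply: glb; first exact: L1B.
  move=> _ [i _ <-]; have := vc i.
  rewrite /v lev_subl_addr addrC -lev_subl_addr.
  by move=> /le_trans; apply; exact: vmeet_lbl.
split=> [i j ij|]; first by apply: Imu_L1_le => //; exact: u_dec.
split=> // [_ [i _ <-]|l _ lT]; first by rewrite -T0; exact: Imu_L1_le.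
(* The lower bound [l] is compared with [0] inside [A], so the argument serves [A] and the corner
   alike. *)
have lTu i : l <= T (u i) by apply: lT; exists i.
suff : T (u i0) <= T (u i0) - l.
  by rewrite lev_subr_addr -[leRHS]addr0 lev_add2l.
apply: (sup_range_le vw) => i /=; rewrite Imu_L1B// lev_add2l lev_opp2.
have [[_ lat] _] := Imu_L1_hom.
by have [_ ->] := lat _ _ (uL i) (uL i0); exact: vmeet_glb.
Qed.

Lemma Imu_L1_sigma_order_continuous (E : set A) : E 0 ->
  sigma_order_continuous_on (L1 mu) E T.
Proof.
move=> E0 u uL; apply: Imu_L1_down => // [|v w vL [v_inc vw]].
  by constructor; exact: 0%N.
by apply: Imu_L1_sup vw => // n; have [] := vL n.
Qed.

(** * Suprema of nets of integrable classes *)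

Section CountableSup.
Context (A_monotone_complete : monotone_complete [set: A]).
Context (A_countable_sup : countable_sup_property [set: A]).

(** The existence of [w], the sequence [l] and the last clause serve Dedekind completeness, the
    countable sup property and order continuity respectively. Positivity of the net is what the
    countable sup property of [A] asks for. *)
Lemma L1_net_sup (I : Type) (leI : I -> I -> Prop) (v : I -> L0 mu)
    (b : L0 mu) : directed leI -> (forall i, L1 mu (v i) /\ 0 <= v i) ->
  increasing_net leI v -> L1 mu b -> (forall i, v i <= b) ->
  exists w, [/\ sup_in (L1 mu) (range v) w,
    exists l : nat -> I, sup_in (L1 mu) (range (v \o l)) w
    & sup_in [set: A] (range (T \o v)) (T w)].
Proof.
move=> dI vL0 v_inc bL vb; have [_ _ _ ub] := dI.
have vL i : L1 mu (v i) by have [] := vL0 i.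
have v0 i : 0 <= v i by have [] := vL0 i.
have T0 : T 0 = 0 by rewrite -(subrr b) Imu_L1B// subrr.
have L10 : L1 mu 0 by rewrite -(subrr b); exact: L1B.
have Tinc : increasing_net leI (T \o v).
  by move=> i j ij; apply: Imu_L1_le => //; exact: v_inc.
have [a Ta] : exists a, sup_in [set: A] (range (T \o v)) a.
  apply: A_monotone_complete dI _ Tinc _ => //.
  by exists (T b) => //; apply/ubound_range => i; exact: Imu_L1_le.
have Tv0 i : 0 <= T (v i) by rewrite -T0; exact: Imu_L1_le.
have a0 : 0 <= a.
  by have [[i0] _ _ _] := dI; exact: le_trans (Tv0 i0) (sup_range_ub i0 Ta).
have [l0 Tl0] := A_countable_sup dI (fun i => conj Logic.I (Tv0 i)) a0
  (conj Tinc Ta).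
have /choice[U UP] : forall ij : I * I, exists k, leI ij.1 k /\ leI ij.2 k.
  by move=> [i j]; exact: ub.
(* The indices [l0] need not increase; directedness yields an increasing sequence [l] whose [n]-th
   term lies above [l0 n]. *)
pose l := fix l n := if n is m.+1 then U (l m, l0 n) else l0 0%N.
have vl_inc : {homo v \o l : m n / (m <= n)%N >-> m <= n}.
  apply: homo_leq => [x//|y x z|n]; first exact: le_trans.
  by apply: v_inc; have [] := UP (l n, l0 n.+1).
have l0l n : v (l0 n) <= v (l n).
  by case: n => [//|n]; apply: v_inc; have [] := UP (l n, l0 n.+1).
have [w vw] : exists w, sup_in (L1 mu) (range (v \o l)) w.
  apply: L1_sigma_dedekind_complete.
  - by move=> _ [n _ <-]; exact: vL.
  - by exists (v (l 0%N)), 0%N.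
  - exact: card_image_le.
  - by exists b => //; apply/ubound_range => n; exact: vb.
have [wL _ w_lub] := vw.
have Tw : sup_in [set: A] (range (T \o (v \o l))) (T w).
  exact: Imu_L1_sup (fun n => vL (l n)) vl_inc vw.
have Twa : T w = a.
  apply: sup_unique Tw _; apply: sup_rangeI => [n|c Tc].
    exact: (sup_range_ub (l n) Ta).
  apply: (sup_range_le Tl0) => n; apply: le_trans (Tc n).
  exact: Imu_L1_le (vL _) (vL _) (l0l n).
have vle i : v i <= w.
  suff <- : vjoin w (v i) = w by exact: vjoin_ubr.
  apply: Imu_L1_inj => //; first exact: L1_join.
  apply/eqP; rewrite eq_le; apply/andP; split; last first.
    by apply: Imu_L1_le => //; [exact: L1_join|exact: vjoin_ubl].
  have jsup : sup_in (L1 mu) (range (fun n => vjoin (v (l n)) (v i)))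
      (vjoin w (v i)).
    split; first exact: L1_join.
      apply/ubound_range => n; apply: vjoin_lub; last exact: vjoin_ubr.
      exact: le_trans (sup_range_ub n vw) (vjoin_ubl _ _).
    move=> c cL /ubound_range jc; apply: vjoin_lub.
      apply: w_lub => //; apply/ubound_range => n.
      exact: le_trans (vjoin_ubl _ _) (jc n).
    exact: le_trans (vjoin_ubr _ _) (jc 0%N).
  have Tj : sup_in [set: A] (range (T \o fun n => vjoin (v (l n)) (v i)))
      (T (vjoin w (v i))).
    apply: Imu_L1_sup jsup => [n|m n mn]; first exact: L1_join.
    apply: vjoin_lub; last exact: vjoin_ubr.
    exact: le_trans (vl_inc _ _ mn) (vjoin_ubl _ _).
  apply: (sup_range_le Tj) => n /=.
  (* For an index [k] beyond [l n] and [i], the join lies below [v k], so its integral does not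
     exceed [a]. *)
  have [k [lk ik]] := ub (l n) i.
  rewrite Twa; apply: le_trans (sup_range_ub k Ta).
  apply: Imu_L1_le => //; first exact: L1_join.
  by apply: vjoin_lub; exact: v_inc.
exists w; split.
- split=> //; first exact/ubound_range.
  move=> c cL /ubound_range vc; apply: w_lub => //.
  by apply/ubound_range => n; exact: vc.
- by exists l.
- by rewrite Twa.
Qed.

(** The net consists of all elements above [s0] and below every upper bound of [S], indexed by
    themselves: this set is closed under joins, hence directed, and contains [vjoin s s0] for each
    [s] in [S]. Subtracting [s0] makes the net positive. *)
Lemma L1_dedekind_complete : dedekind_complete (L1 mu).
Proof.
move=> S SL [s0 Ss0] [b bL Sb].
pose K := [set x | [/\ L1 mu x, s0 <= x
  & forall c : L0 mu, L1 mu c -> ubound S c -> x <= c]].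
pose I := {x : L0 mu | K x}.
have Ks0 : K s0 by split => // [|c _ Sc]; [exact: SL|exact: Sc].
have KL (i : I) : L1 mu (sval i) by case: i => ? [].
have dI : directed (fun i j : I => sval i <= sval j).
  split=> [|i|i j k|[x [xL s0x xle]] [y [yL s0y yle]]] //.
  - by constructor; exists s0.
  - exact: le_trans.
  - have Kj : K (vjoin x y).
      split; first exact: L1_join.
        exact: le_trans s0x (vjoin_ubl _ _).
      by move=> c cL Sc; apply: vjoin_lub; [exact: xle|exact: yle].
    by exists (exist _ _ Kj); split; [exact: vjoin_ubl|exact: vjoin_ubr].
have [||||w [[wL /ubound_range vw w_lub] _ _]] := @L1_net_sup I _
  (fun i => sval i - s0) (b - s0) dI.
- move=> i; split; first by apply: L1B => //; exact: SL.
  by rewrite subv_ge0; case: i => ? [].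
- by move=> i j ij; rewrite lev_add2r.
- by apply: L1B => //; exact: SL.
- by move=> [x [xL s0x xle]] /=; rewrite lev_add2r; exact: xle.
exists (w + s0); split; first by apply: L1D => //; exact: SL.
  move=> s Ss; have Kj : K (vjoin s s0).
    split; first by apply: L1_join; exact: SL.
      exact: vjoin_ubr.
    by move=> c cL Sc; apply: vjoin_lub; exact: Sc.
  rewrite -lev_subl_addr; apply: le_trans (vw (exist _ _ Kj)) => /=.
  by rewrite lev_add2r; exact: vjoin_ubl.
move=> c cL Sc; rewrite -lev_subr_addr; apply: w_lub.
  by apply: L1B => //; exact: SL.
by apply/ubound_range => -[x [xL s0x xle]] /=; rewrite lev_add2r; exact: xle.
Qed.

Lemma L1_countable_sup : countable_sup_property (L1 mu).
Proof.
move=> I leI u x dI uL x0 [u_inc ux]; have [xL /ubound_range u_le_x _] := ux.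
have [w [uw [l ul] _]] := L1_net_sup dI uL u_inc xL u_le_x.
by exists l; rewrite (sup_unique ux uw).
Qed.

Lemma Imu_L1_order_continuous (E : set A) : E 0 ->
  order_continuous_on (L1 mu) E T.
Proof.
move=> E0 I leI u dI uL; have [iI _ _ _] := dI.
apply: Imu_L1_down => // v w vL [v_inc vw].
have [wL /ubound_range v_le_w _] := vw.
have [w' [vw' _ Tw']] := L1_net_sup dI vL v_inc wL v_le_w.
by rewrite (sup_unique vw vw').
Qed.

End CountableSup.

End Quotient.

Theorem theorem4p5 (R : realType) (dX : measure_display)
    (X : measurableType dX) (A : vlAlgType R) (e : A) (mu : vmeasure X A)
    (A_sigma_complete : sigma_dedekind_complete [set: A])
    (e_identity : is_identity [set: A] e) (e_ge0 : 0 <= e)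
    (A_mul_continuous : sigma_monotone_continuous_mul A)
    (mu_spectral : spectral mu) (mu_le_e : mu [set: X] <= e) :
  let B := corner (mu [set: X]) in
  (vl_subalgebra B /\ projection_band B) /\
  [/\ vl_subalgebra (calL1 mu), is_identity (calL1 mu) 1
    & vl_algebra_hom_on (calL1 mu) (Imu mu)] /\
  [/\ bounded_mfun `<=` calL1 mu,
      Imu mu @` bounded_mfun `<=`
        smallest (order_ideal_in B) [set mu [set: X]]
    & Imu mu @` calL1 mu `<=`
        smallest (sigma_order_ideal_in B) [set mu [set: X]]] /\
  [set f | calL1 mu f /\ Imu mu f = 0] = calN mu /\
  [/\ vl_subalgebra (L1 mu), is_identity (L1 mu) (\pi_(L0 mu) 1)
    & forall u v, L1 mu u -> L1 mu v -> u ** v = v ** u] /\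
  [/\ forall f, calL1 mu f -> Imu_L1 mu (\pi_(L0 mu) f) = Imu mu f,
      set_inj (L1 mu) (Imu_L1 mu)
    & vl_algebra_hom_on (L1 mu) (Imu_L1 mu)] /\
  [/\ sigma_dedekind_complete (L1 mu),
      sigma_order_continuous_on (L1 mu) [set: A] (Imu_L1 mu),
      forall u, L1 mu u -> B (Imu_L1 mu u)
    & sigma_order_continuous_on (L1 mu) B (Imu_L1 mu)] /\
  (monotone_complete [set: A] -> countable_sup_property [set: A] ->
   [/\ dedekind_complete (L1 mu), countable_sup_property (L1 mu),
       order_continuous_on (L1 mu) [set: A] (Imu_L1 mu)
     & order_continuous_on (L1 mu) B (Imu_L1 mu)]).
Proof.
move=> B.
have p0 : 0 <= mu [set: X] by exact: vmeasure_ge0.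
have pp : mu [set: X] ** mu [set: X] = mu [set: X].
  by rewrite -mu_spectral// setIT.
have B0 : B 0 by exists 0 => //; rewrite vmul0r vmul0l.
have [L1_1 I1] := calL1_Imu1 A_sigma_complete A_mul_continuous mu_spectral.
have hom := Imu_hom A_sigma_complete A_mul_continuous mu_spectral e_identity
  mu_le_e.
have L1sub := L1_subalgebra A_sigma_complete A_mul_continuous mu_spectral
  e_identity mu_le_e.
have bounded := calL1_bounded A_sigma_complete A_mul_continuous mu_spectral.
have pi_eval := Imu_L1_pi A_sigma_complete A_mul_continuous mu_spectral.
split.
  split; first exact: corner_subalgebra e_identity p0 mu_le_e pp.
  exact: corner_projection_band e_identity p0 mu_le_e pp.
split.
  split=> //; first exact: (calL1_subalgebra A_sigma_complete
    A_mul_continuous mu_spectral e_identity mu_le_e).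
  by split=> // f _; split; [exact: mul1r|exact: mulr1].
split.
  split=> [f|_ [f fb <-] J [Jideal /(_ _ erefl) Jp]|]; first exact: bounded.
    exact: (Imu_bounded_ideal A_sigma_complete A_mul_continuous mu_spectral
      e_identity mu_le_e Jideal Jp fb).
  move=> _ [f fL1 <-] J [Jideal /(_ _ erefl) Jp].
  exact: (Imu_sigma_ideal A_sigma_complete A_mul_continuous mu_spectral
    e_identity mu_le_e Jideal Jp fL1).
split.
  apply/seteqP; split=> [f [fL1 fI]|f fN].
    exact: (calL1_Imu_eq0 A_sigma_complete A_mul_continuous mu_spectral
      e_identity mu_le_e fL1 fI).
  exact: calN_calL1.
split.
  split=> //.
    split; first by exists 1.
    by move=> u [f _ <-]; rewrite -!pi_mul mul1r mulr1.
  by move=> u v [f _ <-] [g _ <-]; rewrite -!pi_mul mulrC.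
split.
  split=> //; last exact: (Imu_L1_hom A_sigma_complete
    A_mul_continuous mu_spectral e_identity mu_le_e).
  move=> u v /set_mem uL /set_mem vL.
  exact: (Imu_L1_inj A_sigma_complete A_mul_continuous mu_spectral
    e_identity mu_le_e uL vL).
split.
  split.
  - exact: (L1_sigma_dedekind_complete A_sigma_complete
      A_mul_continuous mu_spectral e_identity mu_le_e).
  - exact: (Imu_L1_sigma_order_continuous A_sigma_complete
      A_mul_continuous mu_spectral e_identity mu_le_e).
  - by move=> u [f fL1 <-]; rewrite pi_eval//; exact: Imu_corner.
  - exact: (Imu_L1_sigma_order_continuous A_sigma_complete
      A_mul_continuous mu_spectral e_identity mu_le_e).
move=> mc csp; split.
- exact: (L1_dedekind_complete A_sigma_complete A_mul_continuous mu_spectral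
    e_identity mu_le_e mc csp).
- exact: (L1_countable_sup A_sigma_complete A_mul_continuous mu_spectral
    e_identity mu_le_e mc csp).
- exact: (Imu_L1_order_continuous A_sigma_complete A_mul_continuous mu_spectral
    e_identity mu_le_e mc csp).
- exact: (Imu_L1_order_continuous A_sigma_complete A_mul_continuous mu_spectral
    e_identity mu_le_e mc csp).
Qed.
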